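(* Let $T$ be a two-dimensional, non-planar, irreducible subvariety, of constant degree, of the Klein quadric $Q$. Then there exists a constant $r_0=r_0(\deg(T))$ so that, if $L$ is a set of $n$ lines in $\mathbb{R}^3$ whose Plücker images are points in $T$, then, for every $r\ge r_0$, the set $P_{\ge r}(L)$ of $r$-rich points determined by $L$ satisfies $|P_{\ge r}(L)|=O(n/r)$, where the implied constant depends only on $\deg(T)$.
   Context: Plücker space: a line in complex projective 3-space $\mathbb{P}^3$ through distinct points $x=(x_0:x_1:x_2:x_3)$ and $y=(y_0:y_1:y_2:y_3)$ is represented by the point $(\pi_{0,1},\pi_{0,2},\pi_{0,3},\pi_{2,3},\pi_{3,1},\pi_{1,2})\in\mathbb{P}^5$, $\pi_{i,j}=x_iy_j-x_jy_i$. This is a bijection between lines in $\mathbb{P}^3$ and points of the Klein quadric $Q\subset\mathbb{P}^5$, given by $\pi_{0,1}\pi_{2,3}+\pi_{0,2}\pi_{3,1}+\pi_{0,3}\pi_{1,2}=0$. Lines in $\mathbb{R}^3$ are regarded as lines in complex projective 3-space, and varieties are taken over $\mathbb{C}$. ''Non-planar'' means that $T$ is not a 2-flat (a two-dimensional linear subspace of $\mathbb{P}^5$). An $r$-rich point of $L$ is a point of $\mathbb{R}^3$ incident to at least $r$ lines of $L$; $P_{\ge r}(L)$ is the set of all $r$-rich points. *)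

(* Defs.v *)
From mathcomp Require Import all_boot all_order all_algebra.
From mathcomp Require Import boolp classical_sets functions cardinality reals.
From mathcomp Require Import complex mpoly ring.

Set Implicit Arguments.
Unset Strict Implicit.
Unset Printing Implicit Defensive.

Import Order.TTheory GRing.Theory Num.Theory.

Local Open Scope classical_set_scope.
Local Open Scope card_scope.
Local Open Scope complex_scope.
Local Open Scope ring_scope.

(* A point of P^n is a one-dimensional subspace of F^(n+1), so that a subset
   of P^n is a set of such subspaces; (x_0 : ... : x_n) is <[x]>%VS. *)
Definition PSpace (F : fieldType) (n : nat) : set {vspace 'rV[F]_n.+1} :=
  [set p | \dim p = 1%N].

(* The flat cut out on P^n by W; its projective dimension is \dim W - 1. *)
Definition flat (F : fieldType) (n : nat) (W : {vspace 'rV[F]_n.+1}) :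
    set {vspace 'rV[F]_n.+1} :=
  [set p | PSpace p /\ (p <= W)%VS].

Definition zero_locus (F : fieldType) (n : nat) (S : set {mpoly F[n.+1]}) :
    set {vspace 'rV[F]_n.+1} :=
  [set p | PSpace p /\
     forall f v, S f -> v \in p -> f.@[v ord0] = 0].

Definition zariski_closed (F : fieldType) (n : nat)
    (X : set {vspace 'rV[F]_n.+1}) : Prop :=
  exists S : set {mpoly F[n.+1]},
    (forall f, S f -> exists m : nat, f \is m.-homog) /\ X = zero_locus S.

Definition irreducible_variety (F : fieldType) (n : nat)
    (X : set {vspace 'rV[F]_n.+1}) : Prop :=
  [/\ zariski_closed X, X !=set0 &
      forall A B : set {vspace 'rV[F]_n.+1},
        zariski_closed A -> zariski_closed B ->
        X `<=` A `|` B -> X `<=` A \/ X `<=` B].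

(* Z_0 < Z_1 < ... < Z_k, with all the Z_i irreducible and contained in X. *)
Definition has_chain (F : fieldType) (n : nat)
    (X : set {vspace 'rV[F]_n.+1}) (k : nat) : Prop :=
  exists Z : nat -> set {vspace 'rV[F]_n.+1},
    (forall i, (i <= k)%N -> irreducible_variety (Z i) /\ Z i `<=` X) /\
    (forall i, (i < k)%N -> Z i `<` Z i.+1).

(* Krull dimension *)
Definition has_dimension (F : fieldType) (n : nat)
    (X : set {vspace 'rV[F]_n.+1}) (k : nat) : Prop :=
  has_chain X k /\ ~ has_chain X k.+1.

(* The degree of a variety of dimension k is the number of points in which it
   meets a generic flat of codimension k.  Such a flat is the zero set of k
   linear forms, the columns of A, and "generic" means that A lies in a
   nonempty Zariski open subset of the space of matrices (any such open set
   contains a nonempty one of the form g != 0). *)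
Definition has_degree (F : fieldType) (n : nat)
    (X : set {vspace 'rV[F]_n.+1}) (d : nat) : Prop :=
  exists2 k : nat, has_dimension X k &
  exists2 g : {mpoly F[n.+1 * k]}, g != 0 &
    forall A : 'M[F]_(n.+1, k), g.@[mxvec A ord0] != 0 ->
      [set p | X p /\ forall v, v \in p -> v *m A = 0] #= `I_d.

Definition plucker (F : fieldType) (x y : 'rV[F]_4) : 'rV[F]_6 :=
  let pi_ (i j : nat) := x ord0 (inord i) * y ord0 (inord j)
                         - x ord0 (inord j) * y ord0 (inord i) in
  \row_(k < 6)
    [:: pi_ 0 1; pi_ 0 2; pi_ 0 3; pi_ 2 3; pi_ 3 1; pi_ 1 2]%N`_k.

Definition klein_quadric (F : fieldType) : set {vspace 'rV[F]_6} :=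
  [set p | PSpace p /\ forall v : 'rV[F]_6, v \in p ->
     v ord0 (inord 0) * v ord0 (inord 3) + v ord0 (inord 1) * v ord0 (inord 4)
     + v ord0 (inord 2) * v ord0 (inord 5) = 0].

(* Homogeneous coordinates (1 : a_1 : a_2 : a_3) of a point of R^3, over C. *)
Definition homog_coord (R : realType) (a : 'rV[R]_3) : 'rV[R[i]]_4 :=
  \row_(k < 4) [:: 1; (a ord0 (inord 0))%:C; (a ord0 (inord 1))%:C;
                   (a ord0 (inord 2))%:C]`_k.

Definition is_line (R : realType) (l : set 'rV[R]_3) : Prop :=
  exists a v : 'rV[R]_3, v != 0 /\ l = [set a + t *: v | t in [set: R]].

(* The points of P^5 given by the pairs of distinct points of l; by
   plucker_image_line this is a singleton when l is a line. *)
Definition plucker_image (R : realType) (l : set 'rV[R]_3) :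
    set {vspace 'rV[R[i]]_6} :=
  [set p | exists a b : 'rV[R]_3, [/\ l a, l b, a <> b &
     p = <[plucker (homog_coord a) (homog_coord b)]>%VS]].

Definition rich_points (R : realType) (L : set (set 'rV[R]_3)) (r : nat) :
    set 'rV[R]_3 :=
  [set a | `I_r #<= [set l | L l /\ l a]].

Lemma plucker_homog_coord (R : realType) (a v : 'rV[R]_3) (s t : R) :
  plucker (homog_coord (a + s *: v)) (homog_coord (a + t *: v)) =
  (t - s)%:C *: plucker (homog_coord a) (homog_coord (a + v)).
Proof.
apply/rowP => -[k k6]; rewrite !mxE /=.
do 6?[case: k k6 => [|k] k6 /=]; last by [].
all: rewrite !inordK //= !(rmorphD, rmorphN, rmorphM) /=; ring.
Qed.

Lemma plucker_homog_coord_neq0 (R : realType) (a v : 'rV[R]_3) :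
  v != 0 -> plucker (homog_coord a) (homog_coord (a + v)) != 0.
Proof.
apply: contra => /eqP h; apply/eqP/rowP => k.
suff : v ord0 (inord k) = 0 by rewrite inord_val mxE.
have k6 : (k < 6)%N by rewrite (leq_trans (ltn_ord k)).
move: (k : nat) (ltn_ord k) k6 => {}k k3 k6.
have := congr1 (fun u : 'rV[R[i]]_6 => u ord0 (Ordinal k6)) h.
case: k k3 k6 => [|[|[|//]]] /= _ k6.
all: rewrite !mxE !inordK //= !mul1r mulr1 => /(congr1 (@complex.Re R)) /=.
all: by rewrite addrAC subrr add0r.
Qed.

Lemma plucker_image_line (R : realType) (l : set 'rV[R]_3) :
  is_line l -> exists p, PSpace p /\ plucker_image l = [set p].
Proof.
move=> [a [v [v0 ->]]].
have w0 := plucker_homog_coord_neq0 a v0.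
exists <[plucker (homog_coord a) (homog_coord (a + v))]>%VS; split.
  by rewrite /PSpace /= dim_vline w0.
apply/seteqP; split => p /=.
  move=> [_ [_ [[s _ <-] [t _ <-] st ->]]].
  have ts : (t - s)%:C != 0 :> R[i].
    apply/eqP => /(congr1 (@complex.Re R)) /= /subr0_eq ts; apply: st.
    by rewrite ts.
  rewrite plucker_homog_coord; apply/eqP; rewrite eqEsubv -!memvE.
  rewrite memvZ ?memv_line //=; apply/vlineP.
  by exists (t - s)%:C^-1; rewrite scalerA mulVf // scale1r.
move=> ->; exists a, (a + v); split => //.
- by exists 0 => //; rewrite scale0r addr0.
- by exists 1 => //; rewrite scale1r.
- move=> /eqP; rewrite -subr_eq0 opprD addNKr oppr_eq0.
  exact/negP.
Qed.

(* Main.v *)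
Require Import Defs.
From HB Require Import structures.
From mathcomp Require Import all_boot all_order all_algebra.
From mathcomp Require Import boolp classical_sets functions cardinality reals.
From mathcomp Require Import complex mpoly.
From mathcomp Require Import separable ring lra zify.

(** Why the bound holds.

    In Plucker coordinates the lines through a point p form a 2-flat, and the
    lines meeting a given line x form the section of the Klein quadric by the
    polar hyperplane of x.  Call a line special if all the lines of T meet it.

    Two distinct special lines cannot pass through a common point p: a line
    meeting both passes through p or lies in their plane, so the irreducible T
    would lie in one of two 2-flats, hence be equal to it because its dimension
    is 2 ([polar_hyperplanes_parallel], [contained_in_flat]).  So a point on r
    lines of L lies on at least r - 1 lines of L that are not special, and it is
    enough to see that a line l of L that is not special carries fewer than k
    points of richness greater than k, where k = 9 d^3 + 1; double counting of
    incidences does the rest ([rich_points_count]).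

    Suppose that l is not special and carries k such points p_i.  The polar
    hyperplane of l cuts T in a curve, which contains many points of the k
    2-flats of the p_i.  If lam is the equation of that hyperplane, mu_i a linear
    form vanishing on the 2-flat of p_i, and theta / eta separates the lines, the
    k^3 forms lam^n theta^j eta^(2k-2-n-j) prod_(i' != i) mu_i' of degree 3k-3
    are linearly independent on T: divide by lam repeatedly, and at each stage
    restrict to the lines of L through each p_i ([many_curves_contradiction]).
    This is too many, since the forms of degree M on T span a space of dimension
    at most d (dM + 1)^2 ([interpolation_set]).

    That last estimate is where the degree enters.  Project T to the plane by
    three linear forms l_0, l_1, l_2 without common zero on T.  By the
    Nullstellensatz the coordinate ring of T is a finite module over C[l_0, l_1, l_2]
    ([finite_module]); the l_i are algebraically independent because T has
    dimension 2 ([surface_forms_independent]).  A form s of degree M on T has a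
    minimal polynomial over C[l_0, l_1, l_2], monic by a Gauss lemma
    ([scaled_monic_dvd]).  Over a generic point of the plane its roots are distinct
    and each is the value of s at a point of the fibre ([lying_over]), which lies in
    a section with d points; so it has degree at most d ([degree_bound]).  Its constant
    term is then a form of degree at most dM in the l_i.  If s vanishes on the
    fibres over a (dM + 1) x (dM + 1) grid, so does this constant term, which is
    therefore 0, and s vanishes on T ([interpolation_projected]). *)

Set Implicit Arguments.
Unset Strict Implicit.
Unset Printing Implicit Defensive.

Import Order.TTheory GRing.Theory Num.Theory.

Local Open Scope classical_set_scope.
Local Open Scope card_scope.
Local Open Scope complex_scope.
Local Open Scope ring_scope.

(** * Polynomials in several variables restricted to lines *)

Section LineRestriction.
Variables (F A : comNzRingType) (iota : {rmorphism F -> A}) (n : nat).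
Implicit Types (a b : 'I_n -> A) (f : {mpoly F[n]}).

(** The restriction of a polynomial to the parametrized line [t |-> a + t b].  The
    coefficients live in an F-algebra A so that the base point can be generic. *)
Definition mline a b : {mpoly F[n]} -> {poly A} :=
  mmap (polyC \o iota) (fun i => (a i)%:P + b i *: 'X).

HB.instance Definition _ a b := GRing.RMorphism.copy (mline a b) (mline a b).

(** On a monomial of degree m the restriction has degree at most m, and its
    coefficient of degree m depends on the direction b alone. *)
Lemma mmap1_line_top a b (m : 'X_{1..n}) :
  let p : {poly A} := mmap1 (fun i => (a i)%:P + b i *: 'X) m in
  (size p <= (mdeg m).+1)%N /\ p`_(mdeg m) = mmap1 b m.
Proof.
pose Q (p : {poly A}) (k : nat) (c : A) := (size p <= k.+1)%N /\ p`_k = c.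
have QM p k c q l e : Q p k c -> Q q l e -> Q (p * q) (k + l)%N (c * e).
  move=> [sp cp] [sq cq]; split.
    apply: leq_trans (size_polyMleq _ _) _.
    by move: sp sq; lia.
  rewrite coefM (bigD1 (inord k)) //= inordK ?leq_addr ?ltnS ?leq_addr //.
  rewrite addKn cp cq big1 ?addr0 // => i.
  rewrite -val_eqE /= inordK ?ltnS ?leq_addr // => ik.
  have [ltik|leki] := ltnP k i.
    by rewrite (nth_default 0 (leq_trans sp ltik)) mul0r.
  rewrite [q`__]nth_default ?mulr0 // (leq_trans sq) //.
  have : (i < k)%N by rewrite ltn_neqAle ik.
  by have := ltn_ord i; lia.
have Q1 : Q 1 0%N 1 by split; rewrite ?size_poly1 ?coef1.
have QX i k : Q (((a i)%:P + b i *: 'X) ^+ k) k (b i ^+ k).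
  elim: k => [|k IH]; first by rewrite !expr0.
  rewrite !exprS -add1n; apply: QM IH; split.
    apply: leq_trans (size_polyD _ _) _; rewrite geq_max.
    rewrite (leq_trans (size_polyC_leq1 _)) //=.
    by rewrite (leq_trans (size_scale_leq _ _)) ?size_polyX.
  by rewrite coefD coefC coefZ coefX mulr1 add0r.
rewrite /mmap1 mdegE -/(Q _ _ _).
elim: (index_enum _) => [|i s IH]; first by rewrite !big_nil.
by rewrite !big_cons; apply: QM.
Qed.

Lemma coef_mline_top a b f D : (msize f <= D.+1)%N ->
  (mline a b f)`_D = mmap iota b (pihomog mdeg D f).
Proof.
move=> sf; rewrite /mline /mmap [in RHS]pihomogE.
rewrite coef_sum -/(mmap iota b _) raddf_sum /= [RHS]big_mkcond /=.
rewrite [RHS]big_seq [LHS]big_seq; apply: eq_bigr => m mf.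
rewrite coefCM; have [st ct] := mmap1_line_top a b m.
case: eqP => [<-|mD]; first by rewrite ct mmapZ mmapX.
rewrite nth_default ?mulr0 // (leq_trans st) //.
by have := msize_mdeg_lt mf; move: sf mD; lia.
Qed.

Lemma size_mline a b f D : (msize f <= D.+1)%N -> (size (mline a b f) <= D.+1)%N.
Proof.
move=> sf; rewrite /mline /mmap big_seq; apply: (leq_trans (size_sum _ _ _)).
apply/bigmax_leqP_seq => m mf _; rewrite mul_polyC.
apply: leq_trans (size_scale_leq _ _) _.
have [st _] := mmap1_line_top a b m; apply: leq_trans st _.
by have := msize_mdeg_lt mf; move: sf; lia.
Qed.

(** On lines through the origin, the powers of the parameter separate the homogeneous
    components. *)
Lemma coef_mline0 b f k :
  (mline (fun=> 0) b f)`_k = mmap iota b (pihomog mdeg k f).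
Proof.
rewrite /mline /mmap [in RHS]pihomogE.
rewrite coef_sum -/(mmap iota b _) raddf_sum /= [RHS]big_mkcond /=.
apply: eq_bigr => m _; rewrite coefCM.
have -> : mmap1 (fun i => (0%:P + b i *: 'X : {poly A})) m
    = mmap1 b m *: 'X^(mdeg m).
  rewrite /mmap1 mdegE.
  elim: (index_enum _) => [|i s IH]; first by rewrite !big_nil scale1r.
  rewrite !big_cons IH polyC0 add0r exprZn.
  by rewrite -scalerAl -scalerAr scalerA exprD.
rewrite coefZ coefXn eq_sym; case: eqP => _; last by rewrite !mulr0.
by rewrite mulr1 mmapZ mmapX.
Qed.

End LineRestriction.

Section MevalLine.
Variables (F : comNzRingType) (n : nat).
Implicit Types (a b : 'I_n -> F) (f : {mpoly F[n]}).

Lemma horner_mline a b f t :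
  (mline idfun a b f).[t] = f.@[fun i => a i + b i * t].
Proof.
rewrite /mline /mmap horner_sum mevalE; apply: eq_bigr => m _ /=.
rewrite hornerCM; congr (_ * _); rewrite /mmap1 horner_prod.
by apply: eq_bigr => i _; rewrite horner_exp hornerD hornerC hornerZ hornerX.
Qed.

End MevalLine.

Section Nonvanishing.
Variable F : numFieldType.

(** An infinite field always leaves room outside the roots: the integers are tried
    in turn. *)
Lemma nonroots (p : {poly F}) (N : nat) : p != 0 ->
  exists s : seq F, [/\ uniq s, size s = N & all (fun x => p.[x] != 0) s].
Proof.
move=> p0; pose s0 : seq F := [seq i%:R | i <- iota 0 (N + size p)].
have us0 : uniq s0.
  by rewrite map_inj_uniq ?iota_uniq // => i j /eqP; rewrite eqr_nat => /eqP.
exists (take N [seq x <- s0 | p.[x] != 0]); split.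
- by rewrite take_uniq // filter_uniq.
- rewrite size_take; case: ltnP => // le; apply/eqP; rewrite eqn_leq le /=.
  rewrite size_filter.
  have : (count (root p) s0 < size p)%N.
    rewrite -size_filter max_poly_roots //; first exact: filter_all.
    exact: filter_uniq.
  have := count_predC (root p) s0; rewrite size_map size_iota.
  rewrite (@eq_count _ (predC (root p)) (fun x => p.[x] != 0)); last first.
    by move=> x /=; rewrite rootE.
  by rewrite size_filter in le; lia.
- by apply/allP => x /mem_take; rewrite mem_filter => /andP[].
Qed.

Lemma nonroot (p : {poly F}) : p != 0 -> exists x, p.[x] != 0.
Proof.
move=> /(nonroots 1)[s [_]]; case: s => [|x s] //= _ /andP[px _].
by exists x.
Qed.

Lemma poly_eq0_eval (p : {poly F}) : (forall t, t != 0 -> p.[t] = 0) -> p = 0.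
Proof.
move=> pt; apply/eqP/negPn/negP => p0.
have Xp0 : 'X * p != 0 by rewrite mulf_neq0 ?polyX_eq0.
have [x] := nonroot Xp0; rewrite hornerM hornerX mulf_eq0 negb_or => /andP[x0].
by rewrite pt ?eqxx.
Qed.

Lemma horner_muni n (f : {mpoly F[n.+1]}) (v : 'I_n.+1 -> F) :
  (map_poly (meval (fun i : 'I_n => v (widen_ord (leqnSn n) i))) (muni f)).[v ord_max]
  = f.@[v].
Proof.
rewrite muniE mevalE rmorph_sum horner_sum; apply: eq_bigr => m _ /=.
rewrite map_polyZ /= map_polyXn hornerZ hornerXn mevalZ mevalX -mulrA.
congr (_ * _); rewrite big_ord_recr /=; congr (_ * _).
by apply: eq_bigr => i _; rewrite mnmE.
Qed.

(** [muni] only rearranges monomials, singling out the last exponent. *)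
Lemma muni_eq0 n (f : {mpoly F[n.+1]}) : muni f = 0 -> f = 0.
Proof.
move=> u0; apply/mpolyP => m0; rewrite mcoeff0.
have := congr1 (fun p : {poly {mpoly F[n]}} => (p`_(m0 ord_max))@_[multinom (m0 (widen_ord (leqnSn n) i)) | i < n]) u0.
rewrite /= coef0 mcoeff0 muniE coef_sum raddf_sum /= => e.
have [m0f|] := boolP (m0 \in msupp f); last by move/memN_msupp_eq0.
move: e; rewrite (bigD1_seq m0) ?msupp_uniq //= coefZ coefXn eqxx mulr1.
rewrite mcoeffZ mcoeffX eqxx mulr1 big1 ?addr0 // => m mm0.
rewrite coefZ coefXn; case: eqP => [em|]; last by rewrite mulr0 mcoeff0.
rewrite mulr1 mcoeffZ mcoeffX; case: eqP => [em'|]; last by rewrite mulr0.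
case/negP: mm0; apply/eqP/mnmP => i.
have [j ->|->//] := unliftP ord_max i.
have -> : lift ord_max j = widen_ord (leqnSn n) j.
  by apply/val_inj; rewrite /= /bump leqNgt ltn_ord.
by have := congr1 (fun m : 'X_{1..n} => m j) em'; rewrite !mnmE.
Qed.

(** Induction on the number of variables: a polynomial in the last variable whose leading
    coefficient survives a specialization of the others has finitely many roots. *)
Lemma meval_nonzero n (f : {mpoly F[n]}) : f != 0 -> exists v, f.@[v] != 0.
Proof.
elim: n f => [|n IH] f f0.
  exists (fun=> 0); move: f0; rewrite (nvar0_mpolyC f) mevalC.
  by rewrite mpolyC_eq0.
have u0 : muni f != 0 by apply: contra_neq f0; apply: muni_eq0.
have [w] := IH (lead_coef (muni f)) (eq_ind _ negb u0 _ (esym (lead_coef_eq0 _))).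
move=> lw; have p0 : map_poly (meval w) (muni f) != 0.
  apply: contra_neq lw => e; have := congr1 (fun p : {poly F} => p`_(size (muni f)).-1) e.
  by rewrite coef_map coef0.
have [x px] := nonroot p0.
pose v (i : 'I_n.+1) := if unlift ord_max i is Some j then w j else x.
exists v; rewrite -horner_muni.
have -> : v ord_max = x by rewrite /v unlift_none.
rewrite (@eq_map_poly _ _ _ (meval w)) // => g; apply: meval_eq => i /=.
have -> : widen_ord (leqnSn n) i = lift ord_max i.
  by apply/val_inj; rewrite /= /bump leqNgt ltn_ord.
by rewrite /v liftK.
Qed.

Lemma mpoly_eq0_eval n (f : {mpoly F[n]}) : (forall v, f.@[v] = 0) -> f = 0.
Proof.
by move=> fv; apply/eqP/negPn/negP => /meval_nonzero[v]; rewrite fv eqxx.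
Qed.

End Nonvanishing.

(** * A Gauss lemma for polynomials over a ring of polynomials *)

Section PolyEval.
Variables (F : comNzRingType) (k : nat).

Definition pev (P : {poly {mpoly F[k]}}) (a : 'rV[F]_k) (xi : F) : F :=
  (map_poly (meval (a ord0)) P).[xi].

Lemma pevD P Q a xi : pev (P + Q) a xi = pev P a xi + pev Q a xi.
Proof. by rewrite /pev rmorphD hornerD. Qed.
Lemma pevM P Q a xi : pev (P * Q) a xi = pev P a xi * pev Q a xi.
Proof. by rewrite /pev rmorphM hornerM. Qed.
Lemma pevZ c Q a xi : pev (c *: Q) a xi = c.@[a ord0] * pev Q a xi.
Proof. by rewrite /pev map_polyZ hornerZ. Qed.
Lemma pevC c a xi : pev c%:P a xi = c.@[a ord0].
Proof. by rewrite /pev map_polyC hornerC. Qed.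
Lemma pevX a xi : pev 'X a xi = xi.
Proof. by rewrite /pev map_polyX hornerX. Qed.
End PolyEval.

(** Gauss lemma over [{poly F}].  A root of c kills the product P * Q, hence P or Q,
    and the corresponding linear factor can be cancelled from c and that polynomial.
    Once c is constant the leading coefficient of P is a unit. *)
Lemma lead_coef_scaled_dvd (F : numClosedFieldType) (c : {poly F}) (G P Q : {poly {poly F}}) :
  G \is monic -> c != 0 -> c *: G = P * Q -> forall i, lead_coef P %| P`_i.
Proof.
move=> mG; have [n sc] := ubnP (size c); elim: n => // n IH in c sc P Q *.
move=> c0 e i.
have [/size_poly1P[u u0 cu]|sc1] := boolP (size c == 1%N).
  have lpq : lead_coef P * lead_coef Q = u%:P.
    by rewrite -lead_coefM -e lead_coefZ (monicP mG) mulr1.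
  apply: (@dvdp_trans _ u%:P); first by rewrite -lpq dvdp_mulr.
  by apply: dvdp_trans (dvd1p _); rewrite dvdp1 size_polyC u0.
have [t0] := closed_rootP c sc1; rewrite rootE => /eqP ct.
pose d : {poly F} := 'X - t0%:P.
have d0 : d != 0 by rewrite polyXsubC_eq0.
have dI : injective (fun A : {poly {poly F}} => d *: A).
  by move=> A B; rewrite /= -!mul_polyC => /mulfI; apply; rewrite polyC_eq0.
have div (S : {poly {poly F}}) : map_poly (horner_eval t0) S = 0 ->
    exists S', S = d *: S'.
  move=> S0; exists (\poly_(j < size S) (S`_j %/ d)); apply/polyP => j.
  rewrite coefZ coef_poly; case: ltnP => [_|?]; last by rewrite mulr0 nth_default.
  rewrite mulrC divpK // dvdp_XsubCl rootE.
  by have := congr1 (fun p : {poly F} => p`_j) S0; rewrite coef_map coef0 => /eqP.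
have [c1 ec] : exists c1, c = d * c1.
  exists (c %/ d); rewrite mulrC divpK // dvdp_XsubCl rootE; exact/eqP.
have c10 : c1 != 0 by apply: contra_neq c0 => c1z; rewrite ec c1z mulr0.
have sc2 : (size c1 < n)%N.
  by move: sc; rewrite ec size_mul // size_XsubC.
have := congr1 (map_poly (horner_eval t0)) e.
rewrite map_polyZ rmorphM /= [horner_eval t0 c]ct scale0r => /esym/eqP.
rewrite mulf_eq0 => /orP[]/eqP/div[S' eS].
  rewrite eS lead_coefZ coefZ dvdp_mul2l //; apply: (IH c1 sc2 S' Q c10).
  by apply: dI; rewrite scalerA -ec e eS scalerAl.
apply: (IH c1 sc2 P S' c10).
by apply: dI; rewrite scalerA -ec e eS scalerAr.
Qed.

Lemma coef_pihomog (F : comNzRingType) n (f : {mpoly F[n]}) D m :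
  (pihomog mdeg D f)@_m = if mdeg m == D then f@_m else 0.
Proof.
rewrite pihomogE raddf_sum /= big_mkcond /=.
have E x : (if mdeg x == D then (f@_x *: 'X_[x])@_m else 0)
   = if (x == m) then (if mdeg m == D then f@_m else 0) else 0.
  rewrite mcoeffZ mcoeffX; case: (eqVneq x m) => [->|]; first by rewrite mulr1.
  by rewrite mulr0 if_same.
under eq_bigr do rewrite E.
rewrite -big_mkcond /=; have [mf|mf] := boolP (m \in msupp f).
  by rewrite -big_filter filter_pred1_uniq ?msupp_uniq // big_seq1.
rewrite big_seq_cond big_pred0 ?(memN_msupp_eq0 mf) ?if_same // => x.
by apply/negP => /andP[xf /eqP xm]; rewrite -xm xf in mf.
Qed.

Lemma pihomog_top_neq0 (F : comNzRingType) n (f : {mpoly F[n]}) :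
  f != 0 -> pihomog mdeg (msize f).-1 f != 0.
Proof.
move=> f0; apply: contra_neq (f0) => /(congr1 (mcoeff (mlead f))).
rewrite coef_pihomog mcoeff0 -(mlead_deg f0) eqxx => /eqP.
by rewrite mleadc_eq0 => /eqP.
Qed.

(** Gauss lemma over [{mpoly F[k]}], reduced to [lead_coef_scaled_dvd] by restriction
    to the lines in a direction beta where the top component of the leading
    coefficient e of P is nonzero.  On a line with generic base point e has a unit as
    leading coefficient, so Euclidean division by it makes sense; the remainders
    vanish because they vanish on every actual line. *)
Lemma scaled_monic_dvd (F : numClosedFieldType) k (N : nat)
    (G P Q : {poly {mpoly F[k]}}) :
  G \is monic -> P != 0 -> lead_coef P ^+ N *: G = P * Q ->
  exists2 P', P' \is monic & P = lead_coef P *: P'.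
Proof.
move=> mG P0 eG; set e := lead_coef P in eG *.
have e0 : e != 0 by rewrite lead_coef_eq0.
pose D := (msize e).-1.
have sD : msize e = D.+1 by rewrite /D -(mpolySpred _ e0).
have [beta btop] := meval_nonzero (pihomog_top_neq0 e0).
rewrite -/D in btop; set u := (pihomog mdeg D e).@[beta] in btop.
pose bC i : {mpoly F[k]} := (beta i)%:MP.
(* tau f is f on the line in direction beta through the generic point *)
pose tau : {rmorphism {mpoly F[k]} -> {poly {mpoly F[k]}}} :=
  mline (@mpolyC k F) (fun i => 'X_i) bC.
have tauE f : (tau f).[0] = f.
  rewrite /= /mline /mmap horner_sum [RHS]mpolyE; apply: eq_bigr => m _.
  rewrite hornerCM mul_mpolyC; congr (_ *: _); rewrite /mmap1 horner_prod.
  rewrite mpolyXE_id; apply: eq_bigr => i _.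
  by rewrite horner_exp hornerD hornerC hornerZ hornerX mulr0 addr0.
have tauL alpha f : map_poly (meval alpha) (tau f) = mline idfun alpha beta f.
  rewrite /= /mline /mmap rmorph_sum; apply: eq_bigr => m _ /=.
  rewrite rmorphM /= map_polyC /= mevalC; congr (_ * _).
  rewrite /mmap1 rmorph_prod; apply: eq_bigr => i _.
  by rewrite rmorphXn rmorphD /= map_polyC /= mevalXU map_polyZ map_polyX /= mevalC.
have ctau : (tau e)`_D = u%:MP.
  rewrite /= coef_mline_top ?sD // /u /bC /mmap mevalE rmorph_sum.
  apply: eq_bigr => m _ /=; rewrite rmorphM rmorph_prod /=; congr (_ * _).
  by apply: eq_bigr => i _; rewrite rmorphXn.
have stau : (size (tau e) <= D.+1)%N by apply: size_mline; rewrite sD.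
pose E : {poly {mpoly F[k]}} := (u^-1)%:MP *: tau e.
have cE : E`_D = 1 by rewrite coefZ ctau -rmorphM /= mulVf.
have sE : size E = D.+1.
  apply/eqP; rewrite eqn_leq (leq_trans (size_scale_leq _ _) stau) /=.
  by rewrite ltnNge; apply/negP => /leq_sizeP/(_ D (leqnn _)); rewrite cE => /eqP; rewrite oner_eq0.
have mE : E \is monic by rewrite monicE lead_coefE sE cE.
have dv i : exists g, P`_i = g * e.
  pose r := Pdiv.Ring.rmodp (tau P`_i) E; pose q := Pdiv.Ring.rdivp (tau P`_i) E.
  have dE : tau P`_i = q * E + r by apply: Pdiv.RingMonic.rdivp_eq.
  suff r0 : r = 0.
    exists (q.[0] * (u^-1)%:MP); rewrite -{1}[P`_i]tauE dE r0 addr0.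
    by rewrite hornerM hornerZ tauE mulrA.
  apply/polyP => j; rewrite coef0; apply: mpoly_eq0_eval => alpha.
  pose L : {rmorphism {mpoly F[k]} -> {poly F}} := mline idfun alpha beta.
  have LE f : L f = map_poly (meval alpha) (tau f) by rewrite tauL.
  have Le : L e = u *: map_poly (meval alpha) E.
    by rewrite LE /E map_polyZ /= mevalC scalerA mulfV // scale1r.
  have Le0 : L e != 0.
    rewrite Le scaler_eq0 (negPf btop) /=; apply/eqP => /(congr1 (fun p : {poly F} => p`_D)).
    by rewrite coef_map cE /= meval1 coef0 => /eqP; rewrite oner_eq0.
  have mLG : map_poly L G \is monic by apply: monic_map.
  have lP : lead_coef (map_poly L P) = L e by rewrite lead_coef_map_eq.
  have := @lead_coef_scaled_dvd F (L e ^+ N) (map_poly L G) (map_poly L P) (map_poly L Q) mLG.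
  rewrite expf_neq0 // -rmorphXn -map_polyZ eG rmorphM => /(_ isT erefl i).
  rewrite coef_map lP => dv0.
  have {dv0}dv : L e %| map_poly (meval alpha) (tau P`_i) by rewrite -(LE P`_i).
  have dvE : map_poly (meval alpha) E %| map_poly (meval alpha) r.
    have -> : map_poly (meval alpha) r = map_poly (meval alpha) (tau P`_i)
       - map_poly (meval alpha) q * map_poly (meval alpha) E.
      by rewrite dE rmorphD rmorphM /= addrC addKr.
    rewrite dvdp_sub ?dvdp_mull //.
    apply: dvdp_trans dv; rewrite Le.
    by rewrite dvdpZr.
  have : map_poly (meval alpha) r = 0.
    apply/eqP; apply: contraTT dvE => r0; apply/negP => /(dvdp_leq r0).
    rewrite leqNgt; apply/negP/negPn; apply: leq_ltn_trans (size_poly _ _) _.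
    have -> : size (map_poly (meval alpha) E) = size E.
      by apply: size_map_poly_id0; rewrite (monicP mE) /= meval1 oner_eq0.
    by rewrite Pdiv.Ring.ltn_rmodp monic_neq0.
  by move/(congr1 (fun p : {poly F} => p`_j)); rewrite coef_map coef0.
have [g gP] := choice dv.
have sP : size P = (size P).-1.+1 by rewrite (polySpred P0).
have gl : g (size P).-1 = 1.
  by apply: (mulIf e0); rewrite -gP mul1r.
exists (\poly_(i < size P) g i).
  by rewrite monicE lead_coef_poly ?gl ?oner_neq0 // sP.
apply/polyP => i; rewrite coefZ coef_poly; case: ltnP => [_|?].
  by rewrite gP mulrC.
by rewrite mulr0 nth_default.
Qed.

(** * Hilbert's Nullstellensatz over an uncountable field *)

(** Cantor's nested intervals: each step avoids one more real of an enumeration. *)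
Lemma realType_uncountable (R : realType) : ~ countable [set: R].
Proof.
move=> /countable_injP[f finj].
pose g (n : nat) : R := xget 0 [set x | f x = n].
have gf x : g (f x) = x.
  rewrite /g; case: xgetP => [y _ /= fy|/(_ x)/(_ erefl)//].
  by apply: finj => //; rewrite inE.
pose step (n : nat) (ab : R * R) : R * R :=
  if g n <= (ab.1 + ab.2) / 2 then ((ab.1 + 2 * ab.2) / 3, ab.2)
  else (ab.1, (2 * ab.1 + ab.2) / 3).
pose I := fix I n := if n is m.+1 then step m (I m) else (0, 1) : R * R.
have Ilt n : (I n).1 < (I n).2.
  elim: n => [|n IH] /=; first exact: ltr01.
  rewrite /step; case: (I n) IH => a b /= ab.
  by case: ifP => _ /=; lra.
have Istep n : ((I n).1 <= (I n.+1).1) && ((I n.+1).2 <= (I n).2) &&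
    ((g n < (I n.+1).1) || ((I n.+1).2 < g n)).
  rewrite /= /step; case: (I n) (Ilt n) => a b /= ab.
  case: (leP (g n) ((a + b) / 2)) => h /=; rewrite ?lexx ?andbT /=; last first.
    by apply/andP; split; [|apply/orP; right]; lra.
  by apply/andP; split; [|apply/orP; left]; lra.
have Imono n k : (I n).1 <= (I (n + k)%N).1 /\ (I (n + k)%N).2 <= (I n).2.
  elim: k => [|k [IH1 IH2]]; first by rewrite addn0.
  rewrite addnS; have /andP[/andP[h1 h2] _] := Istep (n + k)%N.
  by split; [apply: le_trans h1 | apply: le_trans IH2].
have Icross n k : (I n).1 <= (I k).2.
  have [h _] := Imono n (maxn n k - n)%N; have [_ h'] := Imono k (maxn n k - k)%N.
  rewrite !subnKC ?leq_maxl ?leq_maxr // in h h'.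
  by apply: le_trans h _; apply: le_trans h'; apply/ltW.
pose A := [set (I n).1 | n in [set: nat]].
have supA : has_sup A.
  by split; [exists 0, 0%N | exists 1 => _ [n _ <-]; apply: Icross n 0%N].
pose y := sup A.
have lex n : (I n).1 <= y by apply: sup_upper_bound => //; exists n.
have xle n : y <= (I n).2.
  by apply: ge_sup; [exists 0, 0%N | move=> _ [k _ <-]; apply: Icross].
have /andP[_] := Istep (f y); rewrite gf => /orP[]; rewrite ltNge ?lex ?xle //.
Qed.

Section Nullstellensatz.
Variables (F : numClosedFieldType) (n : nat).
Hypothesis uncF : ~ countable [set: F].
Implicit Types (J : set {mpoly F[n]}) (z w : {mpoly F[n]}).

Definition is_ideal J :=
  [/\ J 0, forall p q, J p -> J q -> J (p + q) & forall p q, J q -> J (p * q)].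

Definition adjoin J z : set {mpoly F[n]} :=
  [set f | exists p q, J p /\ f = p + z * q].

Lemma adjoin_ideal J z : is_ideal J -> is_ideal (adjoin J z).
Proof.
move=> [J0 JD JM]; split.
- by exists 0, 0; rewrite mulr0 addr0.
- move=> _ _ [p [q [Jp ->]]] [p' [q' [Jp' ->]]].
  by exists (p + p'), (q + q'); split; [apply: JD | ring].
- move=> f _ [p [q [Jp ->]]].
  by exists (f * p), (f * q); split; [apply: JM | ring].
Qed.

Lemma sub_adjoin J z : J `<=` adjoin J z.
Proof. by move=> p Jp; exists p, 0; rewrite mulr0 addr0. Qed.

Lemma adjoin_mem J z : is_ideal J -> adjoin J z z.
Proof. by move=> [J0 _ _]; exists 0, 1; rewrite mulr1 add0r. Qed.

(** Pigeonhole: otherwise F would be a countable union of finite sets. *)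
Lemma large_fiber (h : F -> nat * nat) :
  exists c, forall N, exists s : seq F,
    [/\ uniq s, size s = N & forall x, x \in s -> h x = c].
Proof.
apply: contrapT => /forallNP nfin; apply: uncF.
have -> : [set: F] = \bigcup_(c in [set: nat * nat]) [set x | h x = c].
  by apply/seteqP; split => // x _; exists (h x).
apply: bigcup_countable; first exact: countableP.
move=> c _; apply: finite_set_countable; apply: contrapT => inf.
apply: (nfin c) => N; have [B Bc sB] := infinite_set_fset N inf.
exists (take N (finmap.enum_fset B)); split.
- by rewrite take_uniq // finmap.fset_uniq.
- by rewrite size_take; case: ltngtP sB.
- by move=> x /mem_take xB; apply: Bc.
Qed.

(** A matrix with more rows than columns has a nontrivial left kernel. *)
Lemma linear_dependency (I T : finType) (q : I -> T -> F) :
  (#|T| < #|I|)%N -> exists2 k : I -> F, (exists i, k i != 0) &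
    forall t, \sum_i k i * q i t = 0.
Proof.
move=> Tm; pose M : 'M[F]_(#|I|, #|T|) := \matrix_(i, j) q (enum_val i) (enum_val j).
have kM : kermx M != 0.
  rewrite -mxrank_eq0 mxrank_ker subn_eq0 -ltnNge.
  exact: leq_ltn_trans (rank_leq_col _) Tm.
have [u /sub_kermxP uM u0] := rowV0Pn kM.
exists (fun i => u ord0 (enum_rank i)).
  apply: contrapT => /forallNP h; case/eqP: u0; apply/rowP => i.
  rewrite mxE; apply/eqP/negPn/negP => ui.
  by apply: (h (enum_val i)); rewrite enum_valK.
move=> t; have := congr1 (fun v : 'rV_#|T| => v ord0 (enum_rank t)) uM.
rewrite mxE [in RHS]mxE => e; rewrite -[RHS]e (reindex (fun j : 'I_#|I| => enum_val j)) /=; last first.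
  by apply: onW_bij; apply: enum_val_bij.
by apply: eq_bigr => i _; rewrite mxE enum_rankK enum_valK.
Qed.

(** Modulo J some power of w is a multiple of z - x, so multiplication by that power
    removes the factor z - x. *)
Lemma clear_linear_factors J w (s : seq F) z v : is_ideal J ->
  (forall rho, exists N, adjoin J (z - rho%:MP) (w ^+ N)) ->
  J (\prod_(x <- s) (z - x%:MP) * v) -> exists N, J (w ^+ N * v).
Proof.
move=> iJ h; have [J0 JD JM] := iJ.
elim: s v => [|x s IH] v.
  by rewrite big_nil mul1r => Jv; exists 0%N; rewrite expr0 mul1r.
rewrite big_cons => Jv; have [N [p [q [Jp e]]]] := h x.
have /IH[N'] : J (\prod_(x <- s) (z - x%:MP) * (w ^+ N * v)).
  rewrite e; set P := \prod_(_ <- _) _ in Jv *.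
  have -> : P * ((p + (z - x%:MP) * q) * v)
     = (P * v) * p + q * ((z - x%:MP) * P * v) by ring.
  by apply: JD; apply: JM.
by rewrite mulrA -exprD => ?; exists (N' + N)%N.
Qed.

(** The replacement for maximal ideals.  If no value rho of z were allowed, every
    z - rho would divide a power of w modulo J.  As F is uncountable, infinitely many
    of the quotients have the same exponent and bounded degree, so finitely many are
    linearly dependent; clearing denominators gives a nonzero univariate polynomial
    u with u(z) w^N in J, and splitting u contradicts [clear_linear_factors]. *)
Lemma adjoin_coordinate J w z : is_ideal J -> (forall N, ~ J (w ^+ N)) ->
  exists rho, forall N, ~ adjoin J (z - rho%:MP) (w ^+ N).
Proof.
move=> iJ hw; have [J0 JD JM] := iJ.
apply: contrapT => /forallNP h.
have {}h rho : exists N, adjoin J (z - rho%:MP) (w ^+ N).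
  by have := h rho => /existsNP[N /contrapT]; exists N.
have /choice[Npq hNpq] rho : exists Npq : nat * {mpoly F[n]} * {mpoly F[n]},
    J Npq.1.2 /\ w ^+ Npq.1.1 = Npq.1.2 + (z - rho%:MP) * Npq.2.
  by have [N [p [q [Jp e]]]] := h rho; exists (N, p, q).
have [[N K] hNK] := large_fiber (fun rho => ((Npq rho).1.1, msize (Npq rho).2)).
have [s [us ss hs]] := hNK (#|{: 'X_{1..n < K}}|.+1).
set m := _.+1 in ss.
pose r (i : 'I_m) := s`_i.
have rs i : r i \in s by rewrite mem_nth // ss.
have rinj : injective r.
  move=> i j /eqP; rewrite nth_uniq ?ss // => /eqP; exact: val_inj.
pose p i := (Npq (r i)).1.2; pose q i := (Npq (r i)).2.
have Jp i : J (p i) by have [] := hNpq (r i).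
have eN i : w ^+ N = p i + (z - (r i)%:MP) * q i.
  by have [_ <-] := hNpq (r i); have := hs _ (rs i) => -[->].
have sq i : msize (q i) = K by have := hs _ (rs i) => -[].
have [k [i0 ki0] ksum] :
    exists2 k : 'I_m -> F, (exists i, k i != 0) &
      forall t : 'X_{1..n < K}, \sum_i k i * (q i)@_t = 0.
  by apply: linear_dependency; rewrite card_ord.
have kq : \sum_i k i *: q i = 0.
  apply/mpolyP => t; rewrite mcoeff0 raddf_sum /=.
  have [tK|tK] := ltnP (mdeg t) K.
    rewrite -[RHS](ksum (BMultinom tK)); apply: eq_bigr => i _.
    by rewrite mcoeffZ.
  rewrite big1 // => i _; rewrite mcoeffZ [_@__]memN_msupp_eq0 ?mulr0 //.
  by apply: msize_mdeg_ge; rewrite sq.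
(* the relation sum k_i q_i = 0, multiplied by all the z - r_i, becomes u(z) w^N in J *)
pose u : {poly F} := \sum_i k i *: \prod_(j | j != i) ('X - (r j)%:P).
have u0 : u != 0.
  apply/negP => /eqP /(congr1 (fun p : {poly F} => p.[r i0])).
  rewrite horner0 horner_sum (bigD1 i0) //= [X in _ + X]big1 ?addr0; last first.
    move=> i ii0; rewrite hornerZ horner_prod (bigD1 i0) 1?eq_sym //=.
    by rewrite hornerXsubC subrr mul0r mulr0.
  rewrite hornerZ horner_prod => /eqP; rewrite mulf_eq0 (negPf ki0) /=.
  apply/negP; apply/prodf_neq0 => j ji0.
  by rewrite hornerXsubC subr_eq0 (inj_eq rinj) eq_sym.
pose ev (f : {poly F}) : {mpoly F[n]} := (map_poly (@mpolyC n F) f).[z].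
have evM f g : ev (f * g) = ev f * ev g by rewrite /ev rmorphM hornerM.
have evX x : ev ('X - x%:P) = z - x%:MP.
  by rewrite /ev rmorphB /= map_polyX map_polyC /= hornerXsubC.
have evP (I : Type) (l : seq I) (P : pred I) (g : I -> F) :
    ev (\prod_(j <- l | P j) ('X - (g j)%:P)) = \prod_(j <- l | P j) (z - (g j)%:MP).
  rewrite /ev rmorph_prod horner_prod; apply: eq_bigr => j _; exact: evX.
have Ju : J (ev u * w ^+ N).
  have -> : ev u * w ^+ N = \sum_i (k i)%:MP * (\prod_(j | j != i) (z - (r j)%:MP)) * p i
      + (\prod_j (z - (r j)%:MP)) * \sum_i k i *: q i.
    rewrite mulr_sumr -big_split /= {1}/ev /u rmorph_sum horner_sum mulr_suml.
    apply: eq_bigr => i _ /=; rewrite map_polyZ hornerZ -/(ev _) evP (eN i).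
    rewrite [X in _ = _ + X * _](bigD1 i) //= -mul_mpolyC /=; ring.
  rewrite kq mulr0 addr0.
  by apply: (big_ind J) => // i _; apply: JM.
have [t eu] := closed_field_poly_normal u.
have Jt : J (\prod_(x <- t) (z - x%:MP) * w ^+ N).
  have -> : \prod_(x <- t) (z - x%:MP) = (lead_coef u)^-1%:MP * ev u.
    rewrite eu lead_coefZ lead_coef_prod_XsubC mulr1 -mul_polyC evM evP.
    rewrite {1}/ev map_polyC hornerC mulrA -rmorphM /= mulVf ?rmorph1 ?mul1r //.
    by rewrite lead_coef_eq0.
  by rewrite -mulrA; apply: JM.
by have [N' ] := clear_linear_factors iJ h Jt; rewrite -exprD; apply: hw.
Qed.

(** Each coordinate in turn is given a value by [adjoin_coordinate], keeping all powers
    of w out of the ideal. *)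
Theorem nullstellensatz J w : is_ideal J -> (forall N, ~ J (w ^+ N)) ->
  exists c : 'I_n -> F, (forall f, J f -> f.@[c] = 0) /\ w.@[c] != 0.
Proof.
move=> iJ hw.
have chain k : (k <= n)%N -> exists (c : 'I_n -> F) J',
    [/\ is_ideal J', J `<=` J', forall N, ~ J' (w ^+ N) &
        forall i : 'I_n, (i < k)%N -> J' ('X_i - (c i)%:MP)].
  elim: k => [|k IH] kn.
    by exists (fun=> 0), J; split.
  have [c [J' [iJ' JJ' hw' hc]]] := IH (ltnW kn).
  have [rho hrho] := adjoin_coordinate 'X_(Ordinal kn) iJ' hw'.
  exists (fun i => if i == Ordinal kn then rho else c i).
  exists (adjoin J' ('X_(Ordinal kn) - rho%:MP)); split => //.
  - exact: adjoin_ideal.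
  - by move=> f /JJ'; apply: sub_adjoin.
  - move=> i; rewrite ltnS leq_eqVlt => /orP[/eqP ik|ik].
      have -> : i = Ordinal kn by apply/val_inj.
      by rewrite eqxx; apply: adjoin_mem.
    rewrite ifN; first exact/sub_adjoin/hc.
    by rewrite -val_eqE /= ltn_eqF.
have [c [J' [iJ' JJ' hw' hc]]] := chain n (leqnn n).
have [J0 JD JM] := iJ'.
have fc f : J' (f - (f.@[c])%:MP).
  elim/mpolyind: f => [|a m f _ _ IH]; first by rewrite meval0 subrr.
  have Xc : J' ('X_[m] - ('X_[m].@[c])%:MP).
    rewrite mevalX mpolyXE_id rmorph_prod /=.
    elim: (index_enum _) => [|i s IHs]; first by rewrite !big_nil subrr.
    rewrite !big_cons; set A := \prod_(_ <- _) _ in IHs *.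
    set B := \prod_(_ <- _) _ in IHs *.
    have pw e : J' ('X_i ^+ e - (c i ^+ e)%:MP).
      elim: e => [|e IHe]; first by rewrite !expr0 subrr.
      have -> : 'X_i ^+ e.+1 - (c i ^+ e.+1)%:MP
         = 'X_i * ('X_i ^+ e - (c i ^+ e)%:MP) + (c i ^+ e)%:MP * ('X_i - (c i)%:MP).
        by rewrite !exprS mpolyCM; ring.
      by apply: JD; apply: JM => //; apply: hc.
    have -> : 'X_i ^+ m i * A - (c i ^+ m i)%:MP * B
       = A * ('X_i ^+ m i - (c i ^+ m i)%:MP) + (c i ^+ m i)%:MP * (A - B) by ring.
    by apply: JD; apply: JM.
  have -> : a *: 'X_[m] + f - ((a *: 'X_[m] + f).@[c])%:MP
    = a%:MP * ('X_[m] - ('X_[m].@[c])%:MP) + (f - (f.@[c])%:MP).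
    by rewrite mevalD mevalZ mpolyCD mpolyCM -mul_mpolyC; ring.
  by apply: JD => //; apply: JM.
exists c; split => [f Jf|].
  apply/eqP/negPn/negP => f0; apply: (hw' 0%N); rewrite expr0.
  have -> : 1 = ((f.@[c])^-1)%:MP * f + (- ((f.@[c])^-1)%:MP) * (f - (f.@[c])%:MP).
    rewrite mulNr mulrBr opprB addrC subrK -rmorphM /= mulVf ?rmorph1 //.
  by apply: JD; apply: JM => //; apply: JJ'.
apply/negP => /eqP w0; apply: (hw' 1%N).
by have := fc w; rewrite w0 mpolyC0 subr0 expr1.
Qed.
End Nullstellensatz.

(** * Affine cones of projective varieties *)

Section Cones.
Variables (F : numClosedFieldType) (n : nat).
Implicit Types (X : set {vspace 'rV[F]_n.+1}) (f g : {mpoly F[n.+1]})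
  (v : 'rV[F]_n.+1).

(** Nonzero homogeneous coordinate vectors of the points of X, so that statements on X
    become pointwise statements on vectors. *)
Definition cone X : set 'rV[F]_n.+1 := [set v | v != 0 /\ X <[v]>%VS].
Definition vanishes X f := forall v, cone X v -> f.@[v ord0] = 0.

Lemma vline_scale t (v : 'rV[F]_n.+1) : t != 0 -> <[t *: v]>%VS = <[v]>%VS.
Proof.
move=> t0; apply/eqP; rewrite eqEsubv -!memvE memvZ ?memv_line //=.
by apply/vlineP; exists t^-1; rewrite scalerA mulVf // scale1r.
Qed.

Lemma cone_scale X t v : t != 0 -> cone X v -> cone X (t *: v).
Proof.
by move=> t0 [v0 Xv]; split; rewrite ?vline_scale // scaler_eq0 negb_or t0.
Qed.

Lemma PSpace_line (p : {vspace 'rV[F]_n.+1}) :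
  PSpace p -> vpick p != 0 /\ p = <[vpick p]>%VS.
Proof.
move=> p1; have v0 : vpick p != 0 by rewrite vpick0 -dimv_eq0 p1.
split => //; apply/esym/eqP; rewrite eqEdim -memvE memv_pick /=.
by rewrite dim_vline v0 p1.
Qed.

Lemma meval_homog m f t (v : 'rV[F]_n.+1) : f \is m.-homog ->
  f.@[(t *: v) ord0] = t ^+ m * f.@[v ord0].
Proof.
move=> /dhomogP hf; rewrite !mevalE mulr_sumr [LHS]big_seq [RHS]big_seq.
apply: eq_bigr => d /hf /= <-; rewrite mdegE mulrCA; congr (_ * _).
rewrite -prodrXr -big_split /=; apply: eq_bigr => i _.
by rewrite mxE exprMn.
Qed.

Lemma meval_scale f t (v : 'rV[F]_n.+1) :
  f.@[(t *: v) ord0] = (mline idfun (fun=> 0) (v ord0) f).[t].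
Proof.
by rewrite horner_mline; apply: meval_eq => i; rewrite mxE add0r mulrC.
Qed.

(** A polynomial in the scaling parameter that vanishes outside 0 is zero; its
    coefficients are the homogeneous components of f. *)
Lemma vanishes_line X f v : vanishes X f -> cone X v ->
  mline idfun (fun=> 0) (v ord0) f = 0.
Proof.
move=> Xf Xv; apply: poly_eq0_eval => t t0.
by rewrite -meval_scale; apply/Xf/cone_scale.
Qed.

Lemma vanishesP_pihomog X f :
  (forall k, vanishes X (pihomog mdeg k f)) -> vanishes X f.
Proof.
move=> h v Xv; rewrite (pihomog_partitionE (leqnn (msize f))) raddf_sum /=.
by rewrite big1 // => k _; apply: h.
Qed.

(** A closed set is recovered from the polynomials vanishing on its cone. *)
Lemma cone_closed X v : zariski_closed X -> v != 0 ->
  (forall f, vanishes X f -> f.@[v ord0] = 0) -> cone X v.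
Proof.
move=> [S [Sh XS]] v0 h; split => //; rewrite XS; split.
  by rewrite /PSpace /= dim_vline v0.
move=> f _ Sf /vlineP[t ->]; have [m hf] := Sh f Sf.
rewrite (meval_homog _ _ hf) h ?mulr0 // => w [w0].
by rewrite XS => -[_]; apply => //; apply: memv_line.
Qed.

Lemma cone_vpick X p : zariski_closed X -> X p -> cone X (vpick p) /\ p = <[vpick p]>%VS.
Proof.
move=> [S [Sh XS]] Xp; have pP : PSpace p by move: Xp; rewrite XS => -[].
by have [p0 pv] := PSpace_line pP; split => //; split; rewrite -?pv.
Qed.

Lemma sub_cone X Y : X `<=` Y -> cone X `<=` cone Y.
Proof. by move=> XY v [v0 /XY]. Qed.

(** Closed sets are cut out by homogeneous equations, so a polynomial that need not be
    homogeneous is replaced by its components. *)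
Definition homog_locus f : set {vspace 'rV[F]_n.+1} :=
  zero_locus [set g | exists k, g = pihomog mdeg k f].

Lemma homog_locus_closed f : zariski_closed (homog_locus f).
Proof.
exists [set g | exists k, g = pihomog mdeg k f]; split => //.
by move=> _ [k ->]; exists k; apply: pihomogP.
Qed.

Lemma homog_locusP f v : v != 0 ->
  (forall k, (pihomog mdeg k f).@[v ord0] = 0) -> homog_locus f <[v]>%VS.
Proof.
move=> v0 h; split; first by rewrite /PSpace /= dim_vline v0.
move=> _ w [k ->] /vlineP[t ->].
by rewrite (meval_homog _ _ (pihomogP _ k f)) h mulr0.
Qed.

Lemma homog_locus_vanishes X f : X `<=` homog_locus f -> vanishes X f.
Proof.
move=> Xf; apply: vanishesP_pihomog => k v [v0 /Xf[_]]; apply.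
  by exists k.
exact: memv_line.
Qed.

(** On the line through a point of the cone, the product of the restrictions of f and g
    is the zero polynomial, so one of them is; hence X is covered by two closed
    sets. *)
Lemma vanishes_prime X f g : irreducible_variety X ->
  vanishes X (f * g) -> vanishes X f \/ vanishes X g.
Proof.
move=> [cX _ irr] Xfg.
have : X `<=` homog_locus f `|` homog_locus g.
  move=> p /(cone_vpick cX)[Xv ->]; set v := vpick p in Xv *.
  have := vanishes_line Xfg Xv; rewrite rmorphM => /eqP.
  have v0 : v != 0 by case: Xv.
  rewrite mulf_eq0 => /orP[]/eqP h; [left|right]; apply: homog_locusP => // k;
    by rewrite -[LHS]/(mmap idfun (v ord0) _) -coef_mline0 h coef0.
move=> /(irr _ _ (homog_locus_closed f) (homog_locus_closed g)).
by case=> /homog_locus_vanishes; [left|right].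
Qed.

Lemma nvanishes_separate X Y : zariski_closed X -> zariski_closed Y -> X `<` Y ->
  exists2 f, vanishes X f & ~ vanishes Y f.
Proof.
move=> cX cY [XY nYX]; apply: contrapT => h.
have [p [Yp nXp]] : exists p, Y p /\ ~ X p.
  apply: contrapT => h'; apply: nYX => p Yp; apply: contrapT => nXp.
  by apply: h'; exists p.
have [Yv pv] := cone_vpick cY Yp; apply: nXp; rewrite pv.
have [] // : cone X (vpick p); apply: cone_closed => //; first by case: Yv.
move=> f Xf; apply: contrapT => fv; apply: h; exists f => // Yf.
by apply/fv/Yf.
Qed.

End Cones.

Section Projection.
Variables (F : numClosedFieldType) (n k : nat).
Hypothesis uncF : ~ countable [set: F].
Variables (X : set {vspace 'rV[F]_n.+1}) (A : 'M[F]_(n.+1, k)).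

Definition linear_form (j : 'I_k) : {mpoly F[n.+1]} := \sum_i A i j *: 'X_i.

Lemma linear_formE j (v : 'rV[F]_n.+1) :
  (linear_form j).@[v ord0] = (v *m A) ord0 j.
Proof.
rewrite /linear_form raddf_sum mxE; apply: eq_bigr => i _ /=.
by rewrite mevalZ mevalXU mulrC.
Qed.

(** The linear forms given by the columns of A define a morphism on X. *)
Definition no_common_zero := forall v, cone X v -> v *m A != 0.

Hypothesis cX : zariski_closed X.
Hypothesis ncz : no_common_zero.

(** By the Nullstellensatz every coordinate has a power in the ideal generated by the
    forms and the equations of X; taking homogeneous components fixes the degrees of
    the cofactors. *)
Lemma power_in_forms : exists N, forall i, exists q : 'I_k -> {mpoly F[n.+1]},
  (forall j, q j \is N.-homog) /\
  forall v, cone X v ->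
    v ord0 i ^+ N.+1 = \sum_j (v *m A) ord0 j * (q j).@[v ord0].
Proof.
pose J := [set f | exists p (q : 'I_k -> {mpoly F[n.+1]}),
   vanishes X p /\ f = p + \sum_j linear_form j * q j].
have iJ : is_ideal J.
  split.
  - exists 0, (fun=> 0); split; first by move=> v _; rewrite meval0.
    by rewrite big1 ?addr0 // => j _; rewrite mulr0.
  - move=> _ _ [p [q [Xp ->]]] [p' [q' [Xp' ->]]].
    exists (p + p'), (fun j => q j + q' j); split.
      by move=> v Xv; rewrite mevalD Xp // Xp' // addr0.
    under [in RHS]eq_bigr do rewrite mulrDr.
    by rewrite big_split /= addrACA.
  - move=> f _ [p [q [Xp ->]]]; exists (f * p), (fun j => f * q j); split.
      by move=> v Xv; rewrite mevalM Xp ?mulr0.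
    by rewrite mulrDr mulr_sumr; under eq_bigr do rewrite mulrCA.
have pw i : exists N, J ('X_i ^+ N).
  (* otherwise the forms have a common zero c on X with c_i <> 0 *)
  apply: contrapT => /forallNP h.
  have [c [Jc ci]] := nullstellensatz uncF iJ h.
  rewrite mevalXU in ci; pose v : 'rV[F]_n.+1 := \row_i c i.
  have ev f : f.@[v ord0] = f.@[c] by apply: meval_eq => j; rewrite mxE.
  have Xv : cone X v.
    apply: cone_closed => //.
      by apply: contraNneq ci => /rowP/(_ i); rewrite !mxE => ->.
    move=> f Xf; rewrite ev; apply: Jc; exists f, (fun=> 0); split => //.
    by rewrite big1 ?addr0 // => j _; rewrite mulr0.
  case/eqP: (ncz Xv); apply/rowP => j; rewrite -linear_formE ev mxE.
  apply: Jc; exists 0, (fun j' => (j' == j)%:R); split.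
    by move=> w _; rewrite meval0.
  rewrite add0r (bigD1 j) //= eqxx mulr1 big1 ?addr0 // => j' /negPf ->.
  by rewrite mulr0.
have [N hN] := choice pw; exists (\max_i N i)%N => i.
have [p [q [Xp e]]] : J ('X_i ^+ (\max_i N i).+1).
  have le : (N i <= (\max_i N i).+1)%N by rewrite ltnW // ltnS leq_bigmax.
  by rewrite -(subnK le) exprD; case: iJ => _ _; apply.
set M := (\max_i N i)%N in e *.
exists (fun j => pihomog mdeg M (q j)); split=> [j|v Xv]; first exact: pihomogP.
have := vanishes_line Xp Xv; rewrite -[p](addrK (\sum_j linear_form j * q j)) -e.
rewrite rmorphB rmorphXn rmorph_sum /= => /subr0_eq.
have -> : mline idfun (fun=> 0) (v ord0) 'X_i = v ord0 i *: 'X.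
  by rewrite /mline mmapX mmap1U polyC0 add0r.
move/(congr1 (fun p : {poly F} => p`_M.+1)).
rewrite exprZn coefZ coefXn eqxx mulr1 coef_sum => ->.
apply: eq_bigr => j _; rewrite rmorphM /=.
have -> : mline idfun (fun=> 0) (v ord0) (linear_form j) = (v *m A) ord0 j *: 'X.
  rewrite /linear_form raddf_sum mxE scaler_suml; apply: eq_bigr => l _ /=.
  rewrite /mline -mul_mpolyC rmorphM /= mmapC /= mmapX mmap1U polyC0 add0r.
  by rewrite mul_polyC scalerA mulrC.
by rewrite -scalerAl coefZ coefXM /= coef_mline0.
Qed.

End Projection.

(** * Projections from a centre disjoint from the variety *)

Section FiniteModule.
Variables (F : numClosedFieldType) (n k : nat).
Hypothesis uncF : ~ countable [set: F].
Variables (X : set {vspace 'rV[F]_n.+1}) (A : 'M[F]_(n.+1, k)).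
Hypothesis cX : zariski_closed X.
Hypothesis ncz : no_common_zero X A.

Lemma large_exponent N (M : 'X_{1..n.+1}) :
  (n.+1 * N < mdeg M)%N -> exists i, (N < M i)%N.
Proof.
move=> h; apply: contrapT => /forallNP hM; move: h; rewrite ltnNge => /negP; apply.
rewrite mdegE -[X in (X * _)%N]card_ord -sum_nat_const; apply: leq_sum => i _.
by rewrite leqNgt; apply/negP/hM.
Qed.

(** Finiteness of a projection from a centre disjoint from X, stated through
    multiplication matrices.  Monomials of degree less than D generate: in degree D
    some exponent exceeds N, and [power_in_forms] trades that power for the forms,
    with cofactors of degree D - 1. *)
Lemma finite_module : exists q (y : 'rV[F]_n.+1 -> 'rV[F]_q),
  (forall v, cone X v -> y v != 0) /\
  forall s : {mpoly F[n.+1]}, exists p : 'M[{mpoly F[k]}]_q,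
    forall v, cone X v ->
      y v *m map_mx (meval ((v *m A) ord0)) p = s.@[v ord0] *: y v.
Proof.
have [N hN] := power_in_forms uncF cX ncz.
pose D := (n.+1 * N).+1; pose T : finType := 'X_{1..n.+1 < D}.
pose stab (s : {mpoly F[n.+1]}) := exists p : T -> T -> {mpoly F[k]},
  forall v, cone X v -> forall m : T, s.@[v ord0] * ('X_[m]).@[v ord0]
    = \sum_m' (p m m').@[(v *m A) ord0] * ('X_[bmnm m']).@[v ord0].
have stabX i : stab 'X_i.
  have /choice[p hp] : forall m : T, exists r : T -> {mpoly F[k]},
      forall v, cone X v -> ('X_i).@[v ord0] * ('X_[m]).@[v ord0]
        = \sum_m' (r m').@[(v *m A) ord0] * ('X_[bmnm m']).@[v ord0].
    move=> m; pose M := (U_(i) + m)%MM.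
    have dM : mdeg M = (mdeg m).+1 by rewrite mdegD mdeg1 add1n.
    have [MD|DM] := ltnP (mdeg M) D.
      exists (fun m' => (m' == BMultinom MD)%:R) => v _.
      rewrite -mevalM -mpolyXD -/M (bigD1 (BMultinom MD)) //= eqxx meval1 mul1r.
      by rewrite big1 ?addr0 // => m' /negPf ->; rewrite meval0 mul0r.
    have mD := bmdeg m; have {mD}DM : mdeg M = D by move: mD DM; rewrite dM; lia.
    (* M has the full degree D *)
    have [i' ii'] : exists i', (N < M i')%N by apply: large_exponent; rewrite DM.
    have [q [hq eq]] := hN i'; pose m'' := (M - U_(i') *+ N.+1)%MM.
    have eM : M = (U_(i') *+ N.+1 + m'')%MM.
      rewrite addmC submK //; apply/mnm_lepP => j; rewrite mulmnE mnm1E.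
      by case: eqP => [<-|]; rewrite ?mul1n.
    have dm'' : (N + mdeg m'' = D.-1)%N.
      by move: DM; rewrite eM mdegD mdegMn mdeg1; lia.
    exists (fun t : T => \sum_j 'X_j * ((q j * 'X_[m''])@_(bmnm t))%:MP) => v Xv.
    rewrite -mevalM -mpolyXD -/M eM mpolyXD -mpolyXn mevalM rmorphXn /= mevalXU.
    rewrite (eq v Xv) mulr_suml.
    under [RHS]eq_bigr do rewrite raddf_sum mulr_suml.
    rewrite exchange_big /=; apply: eq_bigr => j _.
    under [RHS]eq_bigr do rewrite mevalM mevalXU mevalC -mulrA -mevalZ.
    rewrite -mulr_sumr -raddf_sum /= -mpolywE ?mevalM ?mulrA //.
    have hqm : q j * 'X_[m''] \is (D.-1).-homog.
      by rewrite -dm''; apply: dhomogM; rewrite ?dhomogX.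
    rewrite msizeE; apply/bigmax_leqP_seq => t tq _.
    by have /= -> := dhomog_mf hqm tq.
  by exists p => v Xv m; apply: hp.
have stabM s t : stab s -> stab t -> stab (s * t).
  move=> [p hp] [r hr]; exists (fun m m'' => \sum_m' r m m' * p m' m'') => v Xv m.
  rewrite mevalM -mulrA hr // mulr_sumr.
  under [RHS]eq_bigr do rewrite raddf_sum mulr_suml.
  rewrite exchange_big /=; apply: eq_bigr => m' _.
  rewrite mulrCA hp // mulr_sumr; apply: eq_bigr => m'' _.
  by rewrite mevalM mulrA.
have stabD s t : stab s -> stab t -> stab (s + t).
  move=> [p hp] [r hr]; exists (fun m m' => p m m' + r m m') => v Xv m.
  rewrite mevalD mulrDl hp // hr // -big_split /=; apply: eq_bigr => m' _.
  by rewrite mevalD mulrDl.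
have stabC c : stab c%:MP.
  exists (fun m m' => (m' == m)%:R * c%:MP) => v Xv m.
  rewrite mevalC (bigD1 m) //= eqxx mul1r mevalC big1 ?addr0 // => m' /negPf ->.
  by rewrite mul0r meval0 mul0r.
have stabA s : stab s.
  elim/mpolyind: s => [|c m s _ _ IH]; first exact: stabC.
  apply: (stabD _ _) => //; rewrite -mul_mpolyC; apply: (stabM _ _); first exact: stabC.
  rewrite mpolyXE_id; apply: (big_ind stab) => [||i _]; [exact: (stabC 1) | exact: stabM |].
  elim: (m i) => [|e IHe]; first by rewrite expr0; apply: (stabC 1).
  by rewrite exprS; apply: stabM.
pose ev (i : 'I_#|{: T}|) : T := enum_val i.
exists #|{: T}|, (fun v => \row_i ('X_[bmnm (ev i)]).@[v ord0]); split.
  move=> v Xv; apply/negP => /eqP/rowP.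
  move=> /(_ (enum_rank (BMultinom (bm0_proof n.+1 (n.+1 * N)%N) : T))).
  by rewrite !mxE /ev enum_rankK /= mpolyX0 meval1 => /eqP; rewrite oner_eq0.
move=> s; have [p hp] := stabA s.
exists (\matrix_(i, j) p (ev j) (ev i)) => v Xv.
apply/rowP => j; rewrite !mxE hp // (reindex ev) /=; last first.
  by apply: onW_bij; apply: enum_val_bij.
by apply: eq_bigr => i _; rewrite !mxE mulrC.
Qed.

(** The equation G(forms, s) = 0 in the coordinate ring of X, checked pointwise on the cone. *)
Definition relation (s : {mpoly F[n.+1]}) (G : {poly {mpoly F[k]}}) :=
  forall v, cone X v -> pev G (v *m A) s.@[v ord0] = 0.

(** Cayley-Hamilton: s is an eigenvalue of its multiplication matrix. *)
Lemma integral_relation s : exists2 G, G \is monic & relation s G.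
Proof.
have [q [y [y0 /(_ s)[p hp]]]] := finite_module.
exists (char_poly p); first exact: char_poly_monic.
move=> v Xv; apply/eqP; rewrite /pev map_char_poly -rootE.
rewrite -eigenvalue_root_char; apply/eigenvalueP.
by exists (y v); [apply: hp | apply: y0].
Qed.

(** Every root of a minimal monic relation is a value of s on the fibre.  Otherwise
    the equations of X, of the fibre over a, and s = xi generate the unit ideal; the
    multiplication matrices turn an expression of 1 into a determinant, a relation H
    with value 1 at (a, xi), although H is a multiple of G. *)
Lemma lying_over s G : G \is monic -> relation s G ->
  (forall H, relation s H -> (size H < size G)%N -> H = 0) ->
  forall (a : 'rV[F]_k) xi, pev G a xi = 0 ->
  exists v : 'rV[F]_n.+1, [/\ forall f, vanishes X f -> f.@[v ord0] = 0, v *m A = a & s.@[v ord0] = xi].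
Proof.
move=> mG rG minG a xi Gaxi.
pose J := [set f | exists p (q : 'I_k -> {mpoly F[n.+1]}) r, vanishes X p /\
   f = p + \sum_j (linear_form A j - (a ord0 j)%:MP) * q j + (s - xi%:MP) * r].
have iJ : is_ideal J.
  split.
  - exists 0, (fun=> 0), 0; split; first by move=> v _; rewrite meval0.
    by rewrite mulr0 addr0 big1 ?addr0 // => j _; rewrite mulr0.
  - move=> _ _ [p [q [r [Xp ->]]]] [p' [q' [r' [Xp' ->]]]].
    exists (p + p'), (fun j => q j + q' j), (r + r'); split.
      by move=> v Xv; rewrite mevalD Xp // Xp' // addr0.
    under [in RHS]eq_bigr do rewrite mulrDr.
    by rewrite big_split /=; ring.
  - move=> f _ [p [q [r [Xp ->]]]]; exists (f * p), (fun j => f * q j), (f * r); split.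
      by move=> v Xv; rewrite mevalM Xp ?mulr0.
    by under [in RHS]eq_bigr do rewrite mulrCA; rewrite -mulr_sumr; ring.
have J1 N : ~ J (1 ^+ N).
  rewrite expr1n => -[p [q [r [Xp e]]]].
  have [d [y [y0 hy]]] := finite_module.
  have /choice[Q hQ] := fun j => hy (q j).
  have [R hR] := hy r.
  pose pevm (b : 'rV[F]_k) x : {rmorphism {poly {mpoly F[k]}} -> F} :=
    horner_eval x \o map_poly (meval (b ord0)).
  pose B : 'M[{poly {mpoly F[k]}}]_d := 1%:M
    - \sum_j ('X_j - (a ord0 j)%:MP)%:P *: map_mx polyC (Q j)
    - ('X - xi%:MP%:P) *: map_mx polyC R.
  have Bev b x : map_mx (pevm b x) B = 1%:M
     - \sum_j (b ord0 j - a ord0 j) *: map_mx (meval (b ord0)) (Q j)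
     - (x - xi) *: map_mx (meval (b ord0)) R.
    have evP (M : 'M_d) : map_mx (pevm b x) (map_mx polyC M) = map_mx (meval (b ord0)) M.
      by apply/matrixP => i j; rewrite !mxE /= map_polyC /horner_eval hornerC.
    rewrite /B !map_mxB map_mx1 map_mxZ evP /= map_mx_sum.
    congr (_ - _ - _ *: _).
      apply: eq_bigr => j _; rewrite map_mxZ evP /= map_polyC /horner_eval hornerC.
      by rewrite /= mevalB mevalXU mevalC.
    by rewrite rmorphB /= map_polyX map_polyC /= /horner_eval hornerXsubC mevalC.
  pose H := \det B.
  have evH b x : pev H b x = \det (map_mx (pevm b x) B) by rewrite det_map_mx.
  have rH : relation s H.
    move=> v Xv; rewrite evH Bev; apply/eqP/det0P; exists (y v); first exact: y0.
    rewrite !mulmxBr mulmx1 mulmx_sumr -scalemxAr hR // scalerA.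
    under eq_bigr do rewrite -scalemxAr hQ // scalerA.
    rewrite -scaler_suml -{1}[y v]scale1r -!scalerBl.
    have := congr1 (meval (v ord0)) e; rewrite meval1 !mevalD Xp // add0r.
    rewrite raddf_sum mevalM mevalB mevalC => ->.
    under [X in (X + _ - _ - _) *: _]eq_bigr do
      rewrite /= mevalM mevalB mevalC linear_formE.
    by rewrite addrAC addrK subrr scale0r.
  have : pev H a xi = 0.
    pose rm := Pdiv.Ring.rmodp H G.
    have eH : H = Pdiv.Ring.rdivp H G * G + rm by apply: Pdiv.RingMonic.rdivp_eq.
    have rm0 : rm = 0.
      apply: minG; last by rewrite Pdiv.Ring.ltn_rmodp monic_neq0.
      by move=> v Xv; have := rH v Xv; rewrite eH pevD pevM rG // mulr0 add0r.
    by rewrite eH rm0 pevD pevM Gaxi mulr0 add0r /pev rmorph0 horner0.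
  rewrite evH Bev subrr scale0r subr0 big1 ?subr0 => [|j _].
    by rewrite det1 => /eqP; rewrite oner_eq0.
  by rewrite subrr scale0r.
have [c [Jc _]] := nullstellensatz uncF iJ J1.
pose v : 'rV[F]_n.+1 := \row_i c i.
have ev f : f.@[v ord0] = f.@[c] by apply: meval_eq => j; rewrite mxE.
have J0 : vanishes X 0 by move=> w _; rewrite meval0.
exists v; split.
- move=> f Xf; rewrite ev; apply: Jc; exists f, (fun=> 0), 0; split => //.
  by rewrite mulr0 addr0 big1 ?addr0 // => j _; rewrite mulr0.
- apply/rowP => j; rewrite -linear_formE ev; apply/eqP; rewrite -subr_eq0.
  rewrite -[X in _ - X](mevalC c) -mevalB; apply/eqP/Jc.
  exists 0, (fun j' => (j' == j)%:R), 0; split => //.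
  rewrite add0r mulr0 addr0 (bigD1 j) //= eqxx mulr1 big1 ?addr0 // => j' /negPf ->.
  by rewrite mulr0.
- rewrite ev; apply/eqP; rewrite -subr_eq0 -[X in _ - X](mevalC c) -mevalB.
  apply/eqP/Jc; exists 0, (fun=> 0), 1; split => //.
  by rewrite add0r mulr1 big1 ?add0r // => j _; rewrite mulr0.
Qed.

End FiniteModule.

(** * Polynomial relations on an irreducible variety, and dimension *)

Lemma pevE (F : comNzRingType) k (P : {poly {mpoly F[k]}}) m a xi : (size P <= m)%N ->
  pev P a xi = \sum_(i < m) (P`_i).@[a ord0] * xi ^+ i.
Proof.
move=> sP; rewrite /pev (horner_coef_wide _ (leq_trans (size_poly _ _) sP)).
by apply: eq_bigr => i _; rewrite coef_map.
Qed.

Section Relations.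
Variables (F : numClosedFieldType) (n k : nat).
Hypothesis uncF : ~ countable [set: F].
Variables (X : set {vspace 'rV[F]_n.+1}) (A : 'M[F]_(n.+1, k)).
Implicit Types (s f : {mpoly F[n.+1]}) (G H : {poly {mpoly F[k]}}).

(** Makes a relation into a polynomial vanishing on X, to which primality applies. *)
Definition pcomp s G : {mpoly F[n.+1]} :=
  (map_poly (comp_mpoly [tuple linear_form A j | j < k]) G).[s].

Lemma meval_comp_forms (v : 'rV[F]_n.+1) (p : {mpoly F[k]}) :
  (p \mPo [tuple linear_form A j | j < k]).@[v ord0] = p.@[(v *m A) ord0].
Proof.
rewrite comp_mpoly_meval; apply: meval_eq => j.
by rewrite tnth_mktuple linear_formE.
Qed.

Lemma meval_pcomp s G (v : 'rV[F]_n.+1) :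
  (pcomp s G).@[v ord0] = pev G (v *m A) s.@[v ord0].
Proof.
rewrite /pcomp (horner_coef_wide _ (size_poly _ _)) raddf_sum /= (pevE _ _ (leqnn _)).
apply: eq_bigr => i _; rewrite mevalM rmorphXn /= coef_map /=.
by rewrite meval_comp_forms.
Qed.

Lemma relation_vanishes s G : relation X A s G <-> vanishes X (pcomp s G).
Proof. by split => h v Xv; have := h v Xv; rewrite meval_pcomp. Qed.

Lemma form_relation_pihomog (Q : {mpoly F[k]}) d :
  (forall v, cone X v -> Q.@[(v *m A) ord0] = 0) ->
  forall v, cone X v -> (pihomog mdeg d Q).@[(v *m A) ord0] = 0.
Proof.
move=> hQ v Xv; rewrite -[LHS]/(mmap idfun ((v *m A) ord0) _) -coef_mline0.
suff -> : mline idfun (fun=> 0) ((v *m A) ord0) Q = 0 by rewrite coef0.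
apply: poly_eq0_eval => t t0; have := hQ _ (cone_scale t0 Xv); rewrite -scalemxAl => e; rewrite -[RHS]e.
by rewrite horner_mline; apply: meval_eq => i; rewrite [RHS]mxE add0r mulrC.
Qed.

Hypothesis irrX : irreducible_variety X.
Hypothesis ncz : no_common_zero X A.
Let cX : zariski_closed X. Proof. by case: irrX. Qed.

(** On X the constant coefficient of a relation for f is a multiple of f.  If it vanishes
    on X, irreducibility allows division of the relation by its variable. *)
Lemma norm_relation f : ~ vanishes X f -> exists r : {mpoly F[k]},
  (exists2 v, cone X v & r.@[(v *m A) ord0] != 0) /\
  forall v, cone X v -> f.@[v ord0] = 0 -> r.@[(v *m A) ord0] = 0.
Proof.
move=> nf; have [G mG rG] := integral_relation uncF cX ncz f.
have : exists2 v, cone X v & (lead_coef G).@[(v *m A) ord0] != 0.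
  apply: contrapT => h; apply: nf => v Xv; case: h; exists v => //.
  by rewrite (monicP mG) meval1 oner_neq0.
have [m] := ubnP (size G); elim: m => // m IH in G rG {mG} *.
move=> sG [v Xv Gv].
have [[w Xw G0w]|] := pselect (exists2 v, cone X v & (G`_0).@[(v *m A) ord0] != 0).
  exists G`_0; split; first by exists w.
  move=> u Xu fu; have := rG u Xu; rewrite fu /pev horner_coef0.
  by rewrite coef_map.
move=> h; have {h}G0 u : cone X u -> (G`_0).@[(u *m A) ord0] = 0.
  by move=> Xu; apply/eqP/negPn/negP => ?; apply: h; exists u.
pose G1 := drop_poly 1 G.
have G1i i : G1`_i = G`_i.+1 by rewrite coef_drop_poly addn1.
have sG1 : size G = (size G1).+1.
  rewrite size_drop_poly; case: (size G) (lead_coefE G) => [|m'] e; last by lia.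
  by move: Gv; rewrite e /= G0 ?eqxx.
have GE : G = (G`_0)%:P + G1 * 'X.
  by apply/polyP => -[|i]; rewrite coefD coefC coefMX /= ?addr0 ?add0r.
apply: (IH G1); first last.
- exists v => //; move: Gv; rewrite !lead_coefE sG1 /=.
  case: (size G1) (sG1) => [|m'] e; last by rewrite /= G1i.
  by rewrite /= G0 ?eqxx.
- by move: sG; rewrite sG1.
apply/relation_vanishes.
have : vanishes X (f * pcomp f G1).
  move=> u Xu; rewrite mevalM meval_pcomp.
  by have := rG u Xu; rewrite {1}GE pevD pevC pevM pevX G0 // add0r mulrC.
by case/(vanishes_prime irrX).
Qed.

Hypothesis indep : forall Q : {mpoly F[k]},
  (forall v, cone X v -> Q.@[(v *m A) ord0] = 0) -> Q = 0.

(** A nonzero relation P of least degree divides a monic one up to a power of its leading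
    coefficient, so the Gauss lemma makes it a multiple of a monic polynomial. *)
Lemma minimal_monic_relation s : exists G, [/\ G \is monic, relation X A s G &
  forall H, relation X A s H -> (size H < size G)%N -> H = 0].
Proof.
have [G0 mG0 rG0] := integral_relation uncF cX ncz s.
have exP : exists m, `[< exists2 P, P != 0 & relation X A s P /\ size P = m >].
  by exists (size G0); apply/asboolP; exists G0; rewrite ?monic_neq0.
case: (ex_minnP exP) => _ /asboolP[P P0 [rP <-]] minP.
have {}minP H : relation X A s H -> (size H < size P)%N -> H = 0.
  move=> rH sH; apply/eqP/negPn/negP => H0; move: sH; rewrite ltnNge minP //.
  by apply/asboolP; exists H.
have e := Pdiv.ComRing.rdivp_eq P G0.
have rm0 : Pdiv.Ring.rmodp G0 P = 0.
  apply: (minP); last by rewrite Pdiv.Ring.ltn_rmodp.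
  move=> v Xv; have := congr1 (fun P => pev P (v *m A) s.@[v ord0]) e.
  by rewrite /= pevZ rG0 // mulr0 pevD pevM rP // mulr0 add0r.
rewrite rm0 addr0 mulrC in e.
have [G mG eG] := scaled_monic_dvd mG0 P0 e.
have l0 : lead_coef P != 0 by rewrite lead_coef_eq0.
exists G; split => // [|H rH sH]; last first.
  by apply: minP => //; rewrite eG size_scale.
have : vanishes X (pcomp s (lead_coef P)%:P * pcomp s G).
  move=> v Xv; rewrite mevalM !meval_pcomp pevC -pevZ -eG; exact: rP.
case/(vanishes_prime irrX) => [h|/relation_vanishes //].
case/eqP: l0; apply: indep => v Xv; have := h v Xv.
by rewrite meval_pcomp pevC.
Qed.

(** Both s and the cone are homogeneous, so the component of weight M deg G of a minimal
    monic relation G is again one. *)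
Lemma minimal_homog_relation s M : s \is M.-homog ->
  exists G, [/\ G \is monic, relation X A s G,
    forall H, relation X A s H -> (size H < size G)%N -> H = 0 &
    G`_0 \is ((size G).-1 * M).-homog].
Proof.
move=> hs; have [G [mG rG minG]] := minimal_monic_relation s.
pose e := (size G).-1.
have sG : size G = e.+1 by rewrite /e (polySpred (monic_neq0 mG)).
pose K := \poly_(i < e.+1) pihomog mdeg ((e - i) * M)%N G`_i.
have Ke : K`_e = 1.
  rewrite coef_poly ltnSn subnn mul0n.
  have -> : G`_e = 1 by move: (monicP mG); rewrite lead_coefE sG.
  by rewrite pihomog_dE // dhomog1.
have sK : size K = e.+1.
  apply/eqP; rewrite eqn_leq size_poly /= ltnNge; apply/negP => /leq_sizeP/(_ e (leqnn _)).
  by rewrite Ke => /eqP; rewrite oner_eq0.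
exists K; split.
- by rewrite monicE lead_coefE sK Ke.
- (* pi is the relation along the line through v; K is read on its term of degree e M *)
  move=> v Xv; pose pi : {poly F} := \sum_(i < e.+1)
    mline idfun (fun=> 0) ((v *m A) ord0) G`_i * (s.@[v ord0] ^+ i *: 'X^(i * M)).
  have pi0 : pi = 0.
    apply: poly_eq0_eval => t t0; have := rG _ (cone_scale t0 Xv).
    rewrite (meval_homog _ _ hs) -scalemxAl (@pevE _ _ _ e.+1) ?sG // => e0; rewrite -[RHS]e0.
    rewrite /pi horner_sum; apply: eq_bigr => i _.
    rewrite hornerM hornerZ hornerXn exprMn -exprM mulnC [t ^+ _ * _]mulrC.
    congr (_ * _); rewrite horner_mline; apply: meval_eq => j.
    by rewrite [RHS]mxE add0r mulrC.
  rewrite (@pevE _ _ _ e.+1) ?sK //.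
  have := congr1 (fun p : {poly F} => p`_(e * M)) pi0.
  rewrite coef0 /pi coef_sum => e0; rewrite -[RHS]e0; apply: eq_bigr => i _.
  rewrite -scalerAr coefZ coefMXn ltnNge leq_mul2r -ltnS ltn_ord orbT /=.
  by rewrite -mulnBl coef_mline0 coef_poly ltn_ord mulrC.
- by move=> H rH sH; apply: minG => //; rewrite sG -sK.
- by rewrite sK coef_poly /= subn0; apply: pihomogP.
Qed.

End Relations.

Section Dimension.
Variables (F : numClosedFieldType) (n : nat).
Hypothesis uncF : ~ countable [set: F].
Implicit Types (X Z : set {vspace 'rV[F]_n.+1}).

(** If the forms satisfy a relation Q on Z, project further from a point l of their target
    with Q l nonzero: the image of Z misses it. *)
Lemma drop_form Z k (A : 'M[F]_(n.+1, k.+1)) (Q : {mpoly F[k.+1]}) :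
  no_common_zero Z A -> Q != 0 ->
  (forall v, cone Z v -> Q.@[(v *m A) ord0] = 0) ->
  exists A' : 'M[F]_(n.+1, k), no_common_zero Z A'.
Proof.
move=> ncz Q0 hQ.
have [[v0 Zv0]|e0] := pselect (exists v, cone Z v); last first.
  by exists 0 => v Zv; case: e0; exists v.
pose d := (msize Q).-1; pose P := pihomog mdeg d Q.
have hP : P \is d.-homog by apply: pihomogP.
have PZ v : cone Z v -> P.@[(v *m A) ord0] = 0.
  by apply: form_relation_pihomog.
have [l0 Pl0] := meval_nonzero (pihomog_top_neq0 Q0); rewrite -/d -/P in Pl0.
have [l Pl] : exists l : 'rV[F]_k.+1, P.@[l ord0] != 0.
  by exists (\row_i l0 i); rewrite (@meval_eq _ _ _ l0) // => i; rewrite mxE.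
have [j lj] : exists j, l ord0 j != 0.
  apply: contrapT => /forallNP h; case/eqP: Pl.
  have -> : l = 0 *: (v0 *m A).
    by apply/rowP => i; rewrite scale0r [RHS]mxE; apply/eqP/negPn/negP/h.
  by rewrite (meval_homog _ _ hP) PZ ?mulr0.
exists (\matrix_(a, i) (A a (lift j i) - l ord0 (lift j i) / l ord0 j * A a j)).
move=> v Zv; apply/negP => /eqP v0'.
have vi i : (v *m A) ord0 i = (v *m A) ord0 j / l ord0 j * l ord0 i.
  have [i' ->|->] := unliftP j i; last by rewrite divfK.
  have e : (v *m A) ord0 (lift j i') - l ord0 (lift j i') / l ord0 j * (v *m A) ord0 j = 0.
    have := congr1 (fun u : 'rV[F]_k => u ord0 i') v0'; rewrite [RHS]mxE => h.
    rewrite -[RHS]h !mxE mulr_sumr -sumrB; apply: eq_bigr => a _.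
    by rewrite mxE mulrBr [in RHS]mulrCA.
  by rewrite (subr0_eq e) mulrC mulrCA mulrC.
have evA : v *m A = ((v *m A) ord0 j / l ord0 j) *: l.
  by apply/rowP => i; rewrite [RHS]mxE; exact: vi.
have := PZ v Zv; rewrite {1}evA (meval_homog _ _ hP) => /eqP.
rewrite mulf_eq0 (negPf Pl) orbF expf_eq0 => /andP[_ /eqP m0].
by have := ncz v Zv; rewrite evA m0 scale0r eqxx.
Qed.

(** A relation between the three forms drops their number to two on the top member
    of the chain.  On each smaller member a polynomial separating it from the next one
    gives, through [norm_relation], a relation that drops the number again.  No form
    remains for the smallest member, which is nonempty. *)
Lemma surface_forms_independent X (A : 'M[F]_(n.+1, 3)) (Q : {mpoly F[3]}) :
  has_chain X 2 -> no_common_zero X A ->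
  (forall v, cone X v -> Q.@[(v *m A) ord0] = 0) -> Q = 0.
Proof.
move=> [Z [hZ ltZ]] ncz hQ; apply/eqP/negPn/negP => Q0.
have [i0 Z0X] := hZ 0%N isT; have [i1 Z1X] := hZ 1%N isT; have [i2 Z2X] := hZ 2%N isT.
have step k (B : 'M[F]_(n.+1, k.+1)) Y Y' : irreducible_variety Y ->
    irreducible_variety Y' -> Y `<` Y' -> no_common_zero Y' B ->
    exists B' : 'M[F]_(n.+1, k), no_common_zero Y B'.
  move=> iY iY' YY' nB; have [cY _ _] := iY; have [cY' _ _] := iY'.
  have [f Yf Y'f] := nvanishes_separate cY cY' YY'.
  have [r [[v Y'v rv] hr]] := norm_relation uncF iY' nB Y'f.
  have subY : cone Y `<=` cone Y' by apply: sub_cone; case: YY'.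
  apply: (@drop_form Y k B r).
  - by move=> u /subY; apply: nB.
  - by apply: contraNneq rv => ->; rewrite meval0.
  - by move=> u Yu; apply: hr; [apply: subY | apply: Yf].
have [A2 n2] := drop_form ncz Q0 hQ.
have n2' : no_common_zero (Z 2) A2 by move=> v /(sub_cone Z2X); apply: n2.
have [A1 n1] := step _ A2 _ _ i1 i2 (ltZ 1%N isT) n2'.
have [A0 n0] := step _ A1 _ _ i0 i1 (ltZ 0%N isT) n1.
have [c0 [p Zp] _] := i0; have [Zv _] := cone_vpick c0 Zp.
by have := n0 _ Zv; rewrite [_ *m _]thinmx0 eqxx.
Qed.

End Dimension.

(** * Interpolation on a surface of given degree *)

Lemma card_II_seq (T : choiceType) (A : set T) d : A #= `I_d ->
  exists s : seq T, [/\ uniq s, size s = d & forall x, A x <-> x \in s].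
Proof.
move=> Ad; have fA : finite_set A by apply/finite_setP; exists d.
exists (finmap.enum_fset (fset_set A)); split.
- exact: finmap.fset_uniq.
- exact: card_fset_set.
- by move=> x; rewrite -[in A x](fset_setK fA) /=.
Qed.

Lemma size_flatten_leq (T : Type) (ss : seq (seq T)) c :
  all (fun s => size s <= c)%N ss -> (size (flatten ss) <= c * size ss)%N.
Proof.
elim: ss => //= s ss IH /andP[sc /IH]; rewrite size_cat mulnS.
exact: leq_add.
Qed.

(** Linear forms on the moment curve: each vector is annihilated by finitely many of them. *)
Lemma avoid_vectors (F : numFieldType) m (s : seq 'rV[F]_m) :
  all (fun x => x != 0) s ->
  exists w : 'cV[F]_m, forall x, x \in s -> (x *m w) ord0 ord0 != 0.
Proof.
move=> s0; pose P (x : 'rV[F]_m) : {poly F} := \poly_(i < m) (if insub i is Some j then x ord0 j else 0).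
have PE (x : 'rV_m) t : (P x).[t] = (x *m (\col_(i < m) t ^+ i)) ord0 ord0.
  rewrite /P horner_poly mxE; apply: eq_bigr => i _.
  by rewrite valK mxE.
have P0 x : x != 0 -> P x != 0.
  apply: contra_neq => e; apply/rowP => j; rewrite mxE.
  have := congr1 (fun p : {poly F} => p`_j) e.
  by rewrite coef_poly ltn_ord valK coef0.
have : \prod_(x <- s) P x != 0.
  by rewrite prodf_seq_neq0; apply/allP => x xs; apply: P0 (allP s0 x xs).
move=> /nonroot[t]; rewrite horner_prod prodf_seq_neq0 => /allP h.
exists (\col_(i < m) t ^+ i) => x /h; by rewrite PE.
Qed.

Lemma horner_line (F : numFieldType) m (a b : 'rV[F]_m) (f : {mpoly F[m]}) t :
  (mline idfun (a ord0) (b ord0) f).[t] = f.@[(a + t *: b) ord0].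
Proof.
by rewrite horner_mline; apply: meval_eq => i; rewrite !mxE mulrC.
Qed.

Section Interpolation.
Variables (F : numClosedFieldType) (n d : nat).
Hypothesis uncF : ~ countable [set: F].
Variable T : set {vspace 'rV[F]_n.+1}.
Hypothesis irrT : irreducible_variety T.
Hypothesis chainT : has_chain T 2.
Variable g : {mpoly F[n.+1 * 2]}.
Hypothesis cardT : forall A : 'M[F]_(n.+1, 2), g.@[mxvec A ord0] != 0 ->
  [set p | T p /\ forall v, v \in p -> v *m A = 0] #= `I_d.

Let cT : zariski_closed T. Proof. by case: irrT. Qed.

Lemma section_points (A : 'M[F]_(n.+1, 2)) : g.@[mxvec A ord0] != 0 ->
  exists s : seq 'rV[F]_n.+1, [/\ uniq [seq <[y]>%VS | y <- s], size s = d,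
    forall y, y \in s -> cone T y &
    forall v, cone T v -> v *m A = 0 -> <[v]>%VS \in [seq <[y]>%VS | y <- s]].
Proof.
move=> gA; have [s [us ss hs]] := card_II_seq (cardT gA).
have E : [seq <[y]>%VS | y <- [seq vpick p | p <- s]] = s.
  rewrite -map_comp -[RHS]map_id; apply/eq_in_map => p /hs[Tp _] /=.
  by have [_ <-] := cone_vpick cT Tp.
exists ([seq vpick p | p <- s]); rewrite E size_map; split => //.
  by move=> y /mapP[p /hs[Tp _] ->]; have [] := cone_vpick cT Tp.
move=> v [v0 Tv] vA; apply/hs; split => // w /vlineP[t ->].
by rewrite -scalemxAl vA scaler0.
Qed.

Variables (w : 'cV[F]_n.+1) (A2 : 'M[F]_(n.+1, 2)).
Let B : 'M[F]_(n.+1, 1 + 2) := row_mx w A2.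

(** The codimension 2 section containing the fibre of the projection B over a, with
    entries linear in a. *)
Definition fiber_forms (a : 'rV[F]_(1 + 2)) : 'M[F]_(n.+1, 2) :=
  a ord0 ord0 *: A2 - w *m rsubmx a.

Lemma fiber_formsE (a : 'rV[F]_(1 + 2)) v : v *m B = a -> v *m fiber_forms a = 0.
Proof.
move=> va; rewrite mulmxBr -scalemxAr mulmxA.
have -> : v *m w = (a ord0 ord0)%:M.
  rewrite -va /B mul_mx_row [LHS]mx11_scalar; congr (_ %:M).
  by rewrite -[X in row_mx _ _ _ X](lshift0 2 0) row_mxEl.
by rewrite -{3}va /B mul_mx_row row_mxKr mul_scalar_mx subrr.
Qed.

(** The genericity condition g on sections, pulled back to the target of the
    projection. *)
Definition fiber_poly : {mpoly F[1 + 2]} :=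
  let M : 'M[{mpoly F[1 + 2]}]_(n.+1, 2) :=
    'X_ord0 *: map_mx (@mpolyC _ _) A2
     - map_mx (@mpolyC _ _) w *m \row_j 'X_(rshift 1 j) in
  g \mPo [tuple mxvec M ord0 q | q < n.+1 * 2].

Lemma fiber_polyE (a : 'rV[F]_(1 + 2)) :
  fiber_poly.@[a ord0] = g.@[mxvec (fiber_forms a) ord0].
Proof.
rewrite comp_mpoly_meval; apply: meval_eq => q; rewrite tnth_mktuple.
set M := (X in mxvec X).
have -> : fiber_forms a = map_mx (meval (a ord0)) M.
  apply/matrixP => i j; rewrite /M !mxE !big_ord1 !mxE.
  by rewrite mevalB !mevalM !mevalXU !mevalC.
by rewrite -map_mxvec mxE.
Qed.

Hypothesis gA2 : g.@[mxvec A2 ord0] != 0.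
Hypothesis nczB : no_common_zero T B.

Let indepB (Q : {mpoly F[1 + 2]}) :
  (forall v, cone T v -> Q.@[(v *m B) ord0] = 0) -> Q = 0.
Proof. exact: (surface_forms_independent uncF chainT nczB). Qed.

Lemma fiber_poly_neq0 : fiber_poly != 0.
Proof.
apply/negP => /eqP f0; case/negP: gA2; apply/eqP.
have := fiber_polyE (row_mx 1%:M 0); rewrite f0 meval0 => ->.
by rewrite /fiber_forms row_mxKr mulmx0 subr0 -[X in row_mx _ _ _ X](lshift0 2 0) row_mxEl mxE scale1r.
Qed.

(** The norm of the derivative of G gives a nonzero polynomial r outside whose zeros
    the roots of G over a are simple.  Over a generic a they lift to points of a section
    with d points, and these are distinct because the image a fixes the scalar of the
    coordinate vector. *)
Lemma degree_bound s G : G \is monic -> relation T B s G ->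
  (forall H, relation T B s H -> (size H < size G)%N -> H = 0) ->
  ((size G).-1 <= d)%N.
Proof.
move=> mG rG minG; have [->//|e0] := posnP (size G).-1.
have G'0 : deriv G != 0.
  apply/negP => /eqP/(congr1 (fun p : {poly _} => p`_((size G).-2))).
  rewrite coef_deriv coef0 prednK // -lead_coefE (monicP mG) => /eqP.
  by rewrite -mulr_natr mul1r -mpolyC_nat mpolyC_eq0 pnatr_eq0 gtn_eqF.
have nw : ~ vanishes T (pcomp B s (deriv G)).
  move=> /relation_vanishes/minG h; case/eqP: G'0; apply: h.
  by rewrite lt_size_deriv // monic_neq0.
have [r [[v0 Tv0 rv0] hr]] := norm_relation uncF irrT nczB nw.
have r0 : r != 0 by apply: contraNneq rv0 => ->; rewrite meval0.
have X0 : ('X_ord0 : {mpoly F[1 + 2]}) != 0.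
  by rewrite -msize_poly_eq0 msizeX.
have [a0] := meval_nonzero (mulf_neq0 (mulf_neq0 r0 fiber_poly_neq0) X0).
have [a ->] : exists a : 'rV[F]_(1 + 2), forall Q : {mpoly F[1 + 2]}, Q.@[a0] = Q.@[a ord0].
  by exists (\row_i a0 i) => Q; apply: meval_eq => i; rewrite mxE.
rewrite !mevalM mevalXU fiber_polyE !mulf_eq0 !negb_or -andbA => /and3P[ra ga a00].
have lift xi : pev G a xi = 0 -> exists v, [/\ cone T v, v *m B = a & s.@[v ord0] = xi].
  move=> /(lying_over uncF cT nczB mG rG minG)[v [Tv va sv]]; exists v; split => //.
  apply: (cone_closed cT) => //; apply: contraNneq a00 => vz.
  by rewrite -va vz mul0mx mxE.
pose p := map_poly (meval (a ord0)) G.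
have mp : p \is monic by apply: monic_map.
have [l el] := closed_field_poly_normal p.
rewrite (monicP mp) scale1r in el.
have sl : size l = (size G).-1.
  have : size p = size G by apply: size_map_poly_id0; rewrite (monicP mG) meval1 oner_neq0.
  by rewrite el size_prod_XsubC => <-.
have ul : uniq l.
  rewrite -separable_prod_XsubC -el separable_poly.unlock coprimep_def.
  apply/negPn/negP => /closed_rootP[xi]; rewrite root_gcd => /andP[pxi p'xi].
  have [v [Tv va sv]] : exists v, [/\ cone T v, v *m B = a & s.@[v ord0] = xi].
    exact/lift/eqP.
  case/eqP: ra; rewrite -va; apply: hr => //.
  by rewrite meval_pcomp va sv /pev -deriv_map; apply/eqP.
have [S [uS <- hS Sh]] := section_points ga.
rewrite -sl -(size_map (fun y => <[y]>%VS) S).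
have /choice[V hV] xi : exists v, xi \in l -> [/\ cone T v, v *m B = a & s.@[v ord0] = xi].
  have [xil|_] := boolP (xi \in l); last by exists 0.
  have [|v hv] := lift xi; last by exists v.
  by apply/eqP; rewrite /pev -/p -rootE el root_prod_XsubC.
rewrite -(size_map (fun xi => <[V xi]>%VS) l); apply: uniq_leq_size.
  rewrite map_inj_in_uniq // => x x' /hV[_ va sv] /hV[_ va' sv'] eV.
  have : V x \in <[V x']>%VS by rewrite -eV memv_line.
  move=> /vlineP[t ev].
  have t1 : t = 1.
    apply: (mulIf a00); rewrite mul1r -{1}va'.
    by rewrite -va ev -scalemxAl [RHS]mxE.
  by rewrite -sv -sv' ev t1 scale1r.
move=> _ /mapP[x /hV[Tv va _] ->]; apply: Sh => //.
exact: fiber_formsE.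
Qed.

(** The fibres over the grid of points pt t1 t2 are sampled.  When s vanishes on them,
    [lying_over] shows that its minimal relation has only the root 0 there, so that
    its constant coefficient c0 vanishes on the grid; the degree of c0 then makes it
    vanish on the plane of the grid, and everywhere by homogeneity. *)
Lemma interpolation_projected (M : nat) : exists Y : seq 'rV[F]_n.+1,
  (size Y <= d * (d * M).+1 ^ 2)%N /\
  forall s : {mpoly F[n.+1]}, s \is M.-homog ->
    (forall y, y \in Y -> s.@[y ord0] = 0) -> vanishes T s.
Proof.
have X0 : ('X_ord0 : {mpoly F[1 + 2]}) != 0.
  by rewrite -msize_poly_eq0 msizeX.
have [a0] := meval_nonzero (mulf_neq0 fiber_poly_neq0 X0).
have [a ->] : exists a : 'rV[F]_(1 + 2), forall Q : {mpoly F[1 + 2]}, Q.@[a0] = Q.@[a ord0].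
  by exists (\row_i a0 i) => Q; apply: meval_eq => i; rewrite mxE.
rewrite mevalM mevalXU mulf_eq0 negb_or => /andP[ga a00].
pose e1 : 'rV[F]_(1 + 2) := delta_mx ord0 (rshift 1 ord0).
pose e2 : 'rV[F]_(1 + 2) := delta_mx ord0 (rshift 1 ord_max).
pose N := (d * M).+1.
have nr (b e : 'rV[F]_(1 + 2)) : exists s, fiber_poly.@[b ord0] != 0 ->
    [/\ uniq s, size s = N & all (fun t => fiber_poly.@[(b + t *: e) ord0] != 0) s].
  have [b0|_] := boolP (fiber_poly.@[b ord0] != 0); last by exists [::].
  have p0 : mline idfun (b ord0) (e ord0) fiber_poly != 0.
    apply: contraNneq b0 => /(congr1 (fun p : {poly F} => p.[0])).
    by rewrite horner_line horner0 scale0r addr0 => ->.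
  have [s [us ss hs]] := nonroots N p0; exists s => _; split => //.
  by apply: sub_all hs => t; rewrite horner_line.
have [s1 /(_ ga)[us1 ss1 hs1]] := nr a e1.
have [s2 hs2] := choice (fun t => nr (a + t *: e1) e2).
have /choice[rep hrep] (b : 'rV[F]_(1 + 2)) : exists r : seq 'rV[F]_n.+1, (size r <= d)%N /\
    (fiber_poly.@[b ord0] != 0 -> forall v : 'rV[F]_n.+1, cone T v -> v *m fiber_forms b = 0 ->
       exists2 y, y \in r & v \in <[y]>%VS).
  have [b0|_] := boolP (fiber_poly.@[b ord0] != 0); last by exists [::].
  rewrite fiber_polyE in b0; have [S [_ sS _ Sh]] := section_points b0.
  exists S; rewrite sS; split => // _ v Tv /(Sh v Tv)/mapP[y yS e].
  by exists y => //; rewrite -e memv_line.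
pose pt t1 t2 := a + t1 *: e1 + t2 *: e2.
exists (flatten [seq flatten [seq rep (pt t1 t2) | t2 <- s2 t1] | t1 <- s1]); split.
  apply: (@leq_trans (d * N * N)%N); last by rewrite -mulnA mulnn.
  rewrite -{2}ss1 -(size_map (fun t1 => flatten [seq rep (pt t1 t2) | t2 <- s2 t1]) s1).
  apply: size_flatten_leq; apply/allP => _ /mapP[t1 t1s ->].
  have [_ <- _] := hs2 t1 (allP hs1 _ t1s).
  rewrite -(size_map (fun t2 => rep (pt t1 t2)) (s2 t1)); apply: size_flatten_leq.
  by apply/allP => _ /mapP[t2 _ ->]; case: (hrep (pt t1 t2)).
move=> s hs sY; apply: contrapT => nTs.
have [G [mG rG minG hG0]] := minimal_homog_relation uncF irrT nczB indepB hs.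
have ed := degree_bound mG rG minG.
set e := (size G).-1 in ed hG0.
set c0 := G`_0 in hG0.
have sc0 : (msize c0 <= (e * M).+1)%N.
  rewrite msizeE; apply/bigmax_leqP_seq => m mc _.
  by have /= -> := dhomog_mf hG0 mc.
have eN : (e * M < N)%N by rewrite ltnS leq_mul2r ed orbT.
have c0grid t1 t2 : t1 \in s1 -> t2 \in s2 t1 -> c0.@[(pt t1 t2) ord0] = 0.
  move=> t1s t2s; have [_ _ hs2'] := hs2 t1 (allP hs1 _ t1s).
  have gb := allP hs2' _ t2s; rewrite -/(pt t1 t2) in gb.
  set b := pt t1 t2 in gb *.
  have b00 : b ord0 ord0 != 0.
    by rewrite !mxE /= !mulr0 !addr0.
  have sG1 : size G != 1%N.
    apply/negP => /size_poly1P[c c0' eG].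
    have [[_ [p Tp] _] c1] : irreducible_variety T /\ c = 1.
      by split => //; have := monicP mG; rewrite eG lead_coefC.
    have [Tv _] := cone_vpick cT Tp; have := rG _ Tv.
    by rewrite eG c1 pevC meval1 => /eqP; rewrite oner_eq0.
  (* any root of the relation over b lifts to a point of the sampled fibre *)
  have [xi] : exists xi, root (map_poly (meval (b ord0)) G) xi.
    apply/closed_rootP; rewrite size_map_poly_id0 //.
    by rewrite (monicP mG) meval1 oner_neq0.
  rewrite rootE => /eqP pxi.
  have [v [Tv vb sv]] := lying_over uncF cT nczB mG rG minG pxi.
  have {}Tv : cone T v.
    apply: (cone_closed cT) => //; apply: contraNneq b00 => vz.
    by rewrite -vb vz mul0mx mxE.
  have [y yr /vlineP[t ey]] := (hrep b).2 gb v Tv (fiber_formsE vb).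
  have yY : s.@[y ord0] = 0.
    apply: sY; apply/flattenP; exists (flatten [seq rep (pt t1 t2) | t2 <- s2 t1]).
      by apply/mapP; exists t1.
    by apply/flattenP; exists (rep b) => //; apply/mapP; exists t2.
  have x0 : xi = 0 by rewrite -sv ey (meval_homog _ _ hs) yY mulr0.
  by move: pxi; rewrite x0 horner_coef0 coef_map.
have line0 (b u : 'rV[F]_(1 + 2)) ts : uniq ts -> size ts = N ->
    (forall t, t \in ts -> c0.@[(b + t *: u) ord0] = 0) ->
    forall t, c0.@[(b + t *: u) ord0] = 0.
  move=> uts sts h t; rewrite -horner_line.
  suff -> : mline idfun (b ord0) (u ord0) c0 = 0 by rewrite horner0.
  apply/eqP/negPn/negP => p0.
  have := max_poly_roots p0 _ uts; rewrite sts ltnNge (leq_trans _ eN) //.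
    move=> /(_ _)/negP; apply => //; apply/allP => t' /h.
    by rewrite rootE horner_line => ->.
  exact: size_mline.
have c0line t1 t2 : t1 \in s1 -> c0.@[(pt t1 t2) ord0] = 0.
  move=> t1s; have [us2 ss2 _] := hs2 t1 (allP hs1 _ t1s).
  by apply: (line0 _ _ (s2 t1)) => // t ts; apply: c0grid.
have c0all t1 t2 : c0.@[(pt t1 t2) ord0] = 0.
  rewrite /pt addrAC; apply: (line0 _ _ s1) => // t ts.
  by have := c0line t t2 ts; rewrite /pt addrAC.
have c0X : c0 * 'X_ord0 = 0.
  apply: mpoly_eq0_eval => b'.
  have [b ->] : exists b : 'rV[F]_(1 + 2), forall Q : {mpoly F[1 + 2]}, Q.@[b'] = Q.@[b ord0].
    by exists (\row_i b' i) => Q; apply: meval_eq => i; rewrite mxE.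
  rewrite mevalM mevalXU; have [->|b0] := eqVneq (b ord0 ord0) 0; first by rewrite mulr0.
  pose c := b ord0 ord0 / a ord0 ord0.
  have c_neq0 : c != 0 by rewrite mulf_neq0 ?invr_eq0.
  have -> : b = c *: pt (b ord0 (rshift 1 ord0) / c - a ord0 (rshift 1 ord0))
                        (b ord0 (rshift 1 ord_max) / c - a ord0 (rshift 1 ord_max)).
    apply/rowP => i; rewrite !mxE /=.
    have [->|[->|->]] : i = ord0 \/ (i = rshift 1 ord0 \/ i = rshift 1 ord_max).
      by case: i => -[|[|[|//]]] ?; [left|right; left|right; right]; apply/val_inj.
    - by rewrite /= !mulr0 !addr0 /c divfK.
    - by rewrite /= mulr1 mulr0 addr0 addrC subrK mulrC divfK.
    - by rewrite /= mulr0 addr0 mulr1 addrC subrK mulrC divfK.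
  by rewrite (meval_homog _ _ hG0) c0all mulr0 mul0r.
have c00 : c0 = 0 by apply/eqP; move/eqP: c0X; rewrite mulf_eq0 (negPf X0) orbF.
pose G1 := drop_poly 1 G.
have GE : G = G1 * 'X.
  apply/polyP => -[|i]; rewrite coefMX //= ?coef_drop_poly ?addn1 //; exact: c00.
have G10 : G1 = 0.
  apply: minG; last first.
    by rewrite size_drop_poly subn1 prednK // (polySpred (monic_neq0 mG)).
  apply/relation_vanishes.
  have : vanishes T (s * pcomp B s G1).
    move=> u Tu; rewrite mevalM meval_pcomp.
    by have := rG u Tu; rewrite {1}GE pevM pevX mulrC.
  by case/(vanishes_prime irrT).
by move: (monic_neq0 mG); rewrite GE G10 mul0r eqxx.
Qed.

End Interpolation.

Lemma has_chain_leq (F : fieldType) n (X : set {vspace 'rV[F]_n.+1}) k l :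
  (k <= l)%N -> has_chain X l -> has_chain X k.
Proof.
move=> kl [Z [hZ ltZ]]; exists Z; split => i ik; first exact/hZ/(leq_trans ik).
exact/ltZ/(leq_trans ik).
Qed.

Lemma has_dimension_inj (F : fieldType) n (X : set {vspace 'rV[F]_n.+1}) k l :
  has_dimension X k -> has_dimension X l -> k = l.
Proof.
move=> [ck nk] [cl nl]; case: (ltngtP k l) => // lt.
  by case: nk; apply: has_chain_leq cl.
by case: nl; apply: has_chain_leq ck.
Qed.

(** A generic pair of forms cuts T in finitely many points; a third form that
    vanishes at none of them completes a projection defined on all of T. *)
Lemma interpolation_set (F : numClosedFieldType) n d M (T : set {vspace 'rV[F]_n.+1}) :
  ~ countable [set: F] -> irreducible_variety T -> has_dimension T 2 ->
  has_degree T d -> exists Y : seq 'rV[F]_n.+1,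
  (size Y <= d * (d * M).+1 ^ 2)%N /\
  forall s : {mpoly F[n.+1]}, s \is M.-homog ->
    (forall y, y \in Y -> s.@[y ord0] = 0) -> vanishes T s.
Proof.
move=> uncF irrT dimT [k dimk [g g0 cardT]].
have := has_dimension_inj dimk dimT => ek; subst k.
have [chainT _] := dimT; have [c gc] := meval_nonzero g0.
pose A2 : 'M[F]_(n.+1, 2) := vec_mx (\row_i c i).
have gA2 : g.@[mxvec A2 ord0] != 0.
  by rewrite vec_mxK (@meval_eq _ _ _ c) // => i; rewrite mxE.
have [S [_ _ ST Sh]] := section_points irrT cardT gA2.
have [w hw] : exists w : 'cV[F]_n.+1, forall x, x \in S -> (x *m w) ord0 ord0 != 0.
  by apply: avoid_vectors; apply/allP => x /ST[].
apply: (interpolation_projected uncF irrT chainT cardT gA2 (w := w)).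
move=> v Tv; rewrite mul_mx_row; apply/negP => /eqP e.
have vw : v *m w = 0 by rewrite -[LHS](row_mxKl _ (v *m A2)) e linear0.
have vA : v *m A2 = 0 by rewrite -[LHS](row_mxKr (v *m w)) e linear0.
have /mapP[y yS ey] := Sh v Tv vA.
have /vlineP[t et] : y \in <[v]>%VS by rewrite ey memv_line.
by have := hw y yS; rewrite et -scalemxAl vw scaler0 mxE eqxx.
Qed.

(** * Families of curves in a hyperplane section *)

Section LayeredForms.
Variables (F : numClosedFieldType) (n : nat).
Variable T : set {vspace 'rV[F]_n.+1}.
Hypothesis irrT : irreducible_variety T.

Definition lform (c : 'cV[F]_n.+1) : {mpoly F[n.+1]} := linear_form c ord0.

Lemma lformE c (v : 'rV[F]_n.+1) : (lform c).@[v ord0] = (v *m c) ord0 ord0.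
Proof. exact: linear_formE. Qed.

Lemma lform_homog c : lform c \is 1.-homog.
Proof.
rewrite /lform /linear_form; apply: rpred_sum => i _; apply: rpredZ.
by rewrite dhomogX /= mdeg1.
Qed.

Lemma dhomogX1 (f : {mpoly F[n.+1]}) e : f \is 1.-homog -> f ^+ e \is e.-homog.
Proof. by move=> /(dhomogMn e); rewrite mul1n. Qed.

Lemma dhomog_prod_lform (I : finType) (P : pred I) (c : I -> 'cV[F]_n.+1) :
  \prod_(i | P i) lform (c i) \is #|P|.-homog.
Proof.
rewrite -sum1_card; elim/big_rec2: _ => [|i f e _ hf]; first exact: dhomog1.
exact: dhomogM (lform_homog _) hf.
Qed.

(** The expansion in powers of lam is unique on T, as read on a set Z where lam vanishes:
    the term of degree 0 is determined on Z, and the rest can be divided by lam. *)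
Lemma layers_eq0 (lam : {mpoly F[n.+1]}) (Z : set 'rV[F]_n.+1) k
    (S : nat -> {mpoly F[n.+1]}) :
  ~ vanishes T lam -> Z `<=` cone T -> (forall z, Z z -> lam.@[z ord0] = 0) ->
  (forall m, (m < k)%N -> (forall z, Z z -> (S m).@[z ord0] = 0) -> S m = 0) ->
  vanishes T (\sum_(m < k) lam ^+ m * S m) ->
  forall m, (m < k)%N -> forall z, Z z -> (S m).@[z ord0] = 0.
Proof.
move=> nlam ZT lamZ; elim: k S => // k IH S hS.
rewrite big_ord_recl /= expr0 mul1r => TS.
have S0Z z : Z z -> (S 0%N).@[z ord0] = 0.
  move=> Zz; have := TS z (ZT z Zz); rewrite mevalD raddf_sum /= big1 ?addr0 //.
  by move=> i _; rewrite mevalM rmorphXn /= lamZ // exprS !mul0r.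
have S0 : S 0%N = 0 by apply: hS.
case=> [_|m mk]; first exact: S0Z.
apply: (IH (fun m => S m.+1)) => // [m' m'k|]; first exact: hS.
have : vanishes T (lam * \sum_(i < k) lam ^+ i * S i.+1).
  have -> // : lam * (\sum_(i < k) lam ^+ i * S i.+1)
    = S 0%N + \sum_(i < k) lam ^+ bump 0 i * S (bump 0 i).
  rewrite S0 add0r mulr_sumr; apply: eq_bigr => i _.
  by rewrite mulrA -exprS.
by case/(vanishes_prime irrT).
Qed.

Variables (k : nat) (lam : 'cV[F]_n.+1) (mu : 'I_k -> 'cV[F]_n.+1)
  (y : 'I_k -> 'I_k -> 'rV[F]_n.+1) (Y : seq 'rV[F]_n.+1).
Hypothesis yT : forall i j, cone T (y i j).
Hypothesis y_neq : forall i j j', j != j' -> <[y i j]>%VS != <[y i j']>%VS.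
Hypothesis lamy : forall i j, y i j *m lam = 0.
Hypothesis muy : forall i j, y i j *m mu i = 0.
Hypothesis muy' : forall i i' j, i' != i -> (y i j *m mu i') ord0 ord0 != 0.
Hypothesis lamT : ~ vanishes T (lform lam).
Hypothesis sizeY : (size Y < k ^ 3)%N.
Hypothesis interpY : forall s : {mpoly F[n.+1]}, s \is (3 * k.-1).-homog ->
  (forall z, z \in Y -> s.@[z ord0] = 0) -> vanishes T s.

(** The points y i j lie in the hyperplane lam, in the i-th of k flats.  The forms f below
    are more numerous than Y, so a nontrivial combination vanishes on Y, hence on T.
    By [layers_eq0] each layer vanishes at the y i j; the products of the mu isolate
    one i, and a nonzero polynomial of degree less than k in the ratio rho of theta to
    eta cannot have the k roots rho i j. *)
Lemma many_curves_contradiction : False.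
Proof.
pose ys := [seq y ij.1 ij.2 | ij : 'I_k * 'I_k].
have [eta heta] : exists eta : 'cV[F]_n.+1, forall x, x \in ys -> (x *m eta) ord0 ord0 != 0.
  by apply: avoid_vectors; apply/allP => _ /mapP[[i j] _ ->]; have [] := yT i j.
have {}heta i j : (y i j *m eta) ord0 ord0 != 0.
  by apply: heta; apply/mapP; exists (i, j); rewrite ?mem_enum.
(* normalized so that eta takes the value 1 *)
pose z i j := ((y i j *m eta) ord0 ord0)^-1 *: y i j.
have z_inj i : injective (z i).
  move=> j j' e; apply/eqP/negPn/negP => /(y_neq i)/negP; apply.
  by rewrite -(vline_scale (y i j) (invr_neq0 (heta i j))) -/(z i j) e vline_scale ?invr_eq0.
pose zs := [seq x <- [seq z i.1.1 i.1.2 - z i.1.1 i.2 | i : 'I_k * 'I_k * 'I_k] | x != 0].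
have [theta htheta] : exists th : 'cV[F]_n.+1, forall x, x \in zs -> (x *m th) ord0 ord0 != 0.
  by apply: avoid_vectors; apply: filter_all.
pose rho i j := (z i j *m theta) ord0 ord0.
have rho_inj i : injective (rho i).
  move=> j j' e; apply/eqP/negPn/negP => jj'.
  have zz : z i j - z i j' != 0 by rewrite subr_eq0 (inj_eq (z_inj i)).
  have : z i j - z i j' \in zs.
    by rewrite mem_filter zz /=; apply/mapP; exists (i, j, j'); rewrite ?mem_enum.
  move=> /htheta; rewrite mulmxBl mxE [X in _ + X]mxE -/(rho i j) -/(rho i j') e.
  by rewrite subrr eqxx.
have rhoE i j : (y i j *m theta) ord0 ord0 = rho i j * (y i j *m eta) ord0 ord0.
  by rewrite /rho /z -scalemxAl [X in _ = X * _]mxE mulrAC mulVf ?mul1r.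
pose U m i l : {mpoly F[n.+1]} :=
  lform theta ^+ l * lform eta ^+ (2 * k.-1 - m - l) * \prod_(i' | i' != i) lform (mu i').
pose f (t : 'I_k * 'I_k * 'I_k) := lform lam ^+ t.1.1 * U t.1.1 t.1.2 t.2.
have hf t : f t \is (3 * k.-1).-homog.
  case: t => -[m i] l; rewrite /f /U /=.
  have -> : (3 * k.-1 = m + (l + (2 * k.-1 - m - l) + #|[pred i' | i' != i]|))%N.
    rewrite (@eq_card _ _ (predC1 i)) // cardC1 card_ord.
    by have := ltn_ord m; have := ltn_ord l; have := ltn_ord i; lia.
  apply: dhomogM; first exact/dhomogX1/lform_homog.
  apply: dhomogM; last exact: dhomog_prod_lform.
  by apply: dhomogM; apply/dhomogX1/lform_homog.
have [kap [t0 kt0] kapY] : exists2 kap : 'I_k * 'I_k * 'I_k -> F, (exists t, kap t != 0) &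
    forall a : 'I_(size Y), \sum_t kap t * (f t).@[Y`_a ord0] = 0.
  by apply: linear_dependency; rewrite !card_prod !card_ord -mulnA mulnn -expnS.
have Ts : vanishes T (\sum_t kap t *: f t).
  apply: interpY; first by apply: rpred_sum => t _; apply/dhomogZ/hf.
  move=> x xY; rewrite raddf_sum /= -(nth_index 0 xY).
  have aY : (index x Y < size Y)%N by rewrite index_mem.
  by rewrite -[RHS](kapY (Ordinal aY)); apply: eq_bigr => t _; rewrite mevalZ.
(* kap with a first index in nat, for the induction of layers_eq0 *)
pose kp m i l := if insub m is Some m' then kap (m', i, l) else 0.
pose S m := \sum_i \sum_l kp m i l *: U m i l.
have es : \sum_t kap t *: f t = \sum_(m < k) lform lam ^+ m * S m.
  rewrite /S; under [RHS]eq_bigr do rewrite mulr_sumr.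
  rewrite pair_bigA /=; under [RHS]eq_bigr do rewrite mulr_sumr.
  rewrite pair_bigA /=; apply: eq_bigr => -[[m i] l] _.
  by rewrite /f /kp /= valK scalerAr.
have SU m i j : (S m).@[y i j ord0] =
   (\sum_l kp m i l * (U m i l).@[y i j ord0]).
  rewrite raddf_sum (bigD1 i) //= [X in _ + X]big1 ?addr0 => [|i' i'i].
    by rewrite raddf_sum; apply: eq_bigr => l _; rewrite /= mevalZ.
  rewrite raddf_sum big1 // => l _ /=; rewrite mevalZ /U [X in X.@[_]]mulrC mevalM.
  rewrite (bigD1 i) 1?eq_sym //= mevalM lformE muy mxE !mul0r mulr0 //.
have kap0 m : (m < k)%N -> (forall i j, (S m).@[y i j ord0] = 0) ->
    forall i l, kp m i l = 0.
  move=> mk Sy i; pose p := \poly_(l < k) (if insub l is Some l' then kp m i l' else 0).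
  suff p0 : p = 0.
    move=> l; have := congr1 (fun p : {poly F} => p`_l) p0.
    by rewrite coef_poly ltn_ord coef0 valK.
  apply/eqP/negPn/negP => p0.
  have := @max_poly_roots _ p [seq rho i j | j : 'I_k] p0.
  rewrite map_inj_uniq ?enum_uniq; last exact: rho_inj.
  rewrite size_map size_enum_ord ltnNge size_poly => /(_ _ isT) => /(_ _)/notF; apply.
  apply/allP => _ /mapP[j _ ->]; rewrite rootE /p horner_poly.
  have := Sy i j; rewrite SU.
  pose c := (y i j *m eta) ord0 ord0 ^+ (2 * k.-1 - m)
     * \prod_(i' | i' != i) (y i j *m mu i') ord0 ord0.
  have c0 : c != 0.
    by rewrite mulf_neq0 ?expf_neq0 //; apply/prodf_neq0 => i' i'i; apply: muy'.
  have -> : \sum_l kp m i l * (U m i l).@[y i j ord0]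
     = (\sum_(l < k) kp m i l * rho i j ^+ l) * c.
    rewrite mulr_suml; apply: eq_bigr => l _; rewrite -mulrA; congr (_ * _).
    rewrite /U !mevalM !rmorphXn rmorph_prod /= !lformE rhoE exprMn /c.
    rewrite -!mulrA; congr (_ * _); rewrite mulrA -exprD.
    have -> : (l + (2 * k.-1 - m - l) = 2 * k.-1 - m)%N.
      by have := ltn_ord l; lia.
    by congr (_ * _); apply: eq_bigr => i' _; rewrite lformE.
  move/eqP; rewrite mulf_eq0 (negPf c0) orbF => /eqP e.
  by rewrite -[X in _ == X]e; apply/eqP/eq_bigr => l _; rewrite valK.
pose Z := [set x | exists i j, x = y i j].
have ZS m : (m < k)%N -> forall z, Z z -> (S m).@[z ord0] = 0.
  apply: (@layers_eq0 (lform lam) Z) => //.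
  - by move=> _ [i [j ->]].
  - by move=> _ [i [j ->]]; rewrite lformE lamy mxE.
  - move=> m' m'k hS; rewrite /S big1 // => i _; rewrite big1 // => l _.
    rewrite kap0 ?scale0r // => i' j'; apply: hS; by exists i', j'.
  - by rewrite -es.
case: t0 kt0 => -[m i] l; have := kap0 m (ltn_ord m) _ i l.
rewrite /kp valK => -> ; first by rewrite eqxx.
by move=> i' j'; apply: ZS => //; exists i', j'.
Qed.

End LayeredForms.

(** The coordinates of the flat are forms without common zero on T.  An equation of T
    not satisfied on the flat would be a relation between them, which
    [surface_forms_independent] excludes. *)
Lemma contained_in_flat (F : numClosedFieldType) n (T : set {vspace 'rV[F]_n.+1})
    (K : 'M[F]_(3, n.+1)) :
  ~ countable [set: F] -> irreducible_variety T -> has_chain T 2 ->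
  row_free K -> (forall v, cone T v -> (v <= K)%MS) ->
  exists2 W : {vspace 'rV[F]_n.+1}, \dim W = 3%N & T = flat W.
Proof.
move=> uncF irrT chT fK TK; have [cT _ _] := irrT.
pose X := [tuple row i K | i < 3].
have sumK (c : 'I_3 -> F) : \sum_i c i *: X`_i = \row_i c i *m K.
  rewrite mulmx_sum_row; apply: eq_bigr => i _.
  by rewrite mxE -tnth_nth tnth_mktuple.
have fX : free X.
  apply/freeP => c; rewrite sumK -[RHS](mul0mx _ K) => /(row_free_inj fK) h i.
  by have := congr1 (fun r : 'rV[F]_3 => r ord0 i) h; rewrite !mxE.
have memX v : (v <= K)%MS = (v \in <<X>>%VS).
  apply/idP/idP => [/submxP[u ->]|/coord_span ->].
    have -> : u = \row_i u ord0 i by apply/rowP => i; rewrite mxE.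
    rewrite -sumK; apply: memv_suml => i _; apply/memvZ/memv_span.
    by rewrite mem_nth // size_tuple.
  by rewrite sumK submxMl.
exists <<X>>%VS; first by rewrite (eqP fX) size_tuple.
pose A := pinvmx K.
have AK (v : 'rV_n.+1) : (v <= K)%MS -> v *m A *m K = v by apply: mulmxKpV.
have ncz : no_common_zero T A.
  move=> v Tv; apply/negP => /eqP vA; have [v0 _] := Tv.
  by have := AK v (TK v Tv); rewrite vA mul0mx => e; rewrite -e eqxx in v0.
apply/seteqP; split => p.
  move=> Tp; have [Tv ->] := cone_vpick cT Tp; have [v0 _] := Tv.
  by split; [rewrite /PSpace /= dim_vline v0 | rewrite -memvE -memX; apply: TK].
move=> [/PSpace_line[v0 ->]]; set v := vpick p in v0 *.
rewrite -memvE -memX => vK; have [] // : cone T v.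
apply: cone_closed => // f Tf; rewrite -(AK v vK).
rewrite -(meval_comp_forms K (v *m A)).
rewrite [f \mPo _](surface_forms_independent uncF chT ncz) ?meval0 // => u Tu.
by rewrite meval_comp_forms AK ?Tf //; apply: TK.
Qed.

(** * Plucker coordinates of real lines *)

Section Coordinates.
Variable A : comNzRingType.

Definition row3 (a b c : A) : 'rV[A]_3 := \row_(k < 3) [:: a; b; c]`_k.
Definition row6 (a b c d e f : A) : 'rV[A]_6 := \row_(k < 6) [:: a; b; c; d; e; f]`_k.
Definition col6 (a b c d e f : A) : 'cV[A]_6 := (row6 a b c d e f)^T.

Lemma row3P (x : 'rV[A]_3) : exists a b c, x = row3 a b c.
Proof.
exists (x ord0 (inord 0)), (x ord0 (inord 1)), (x ord0 (inord 2)).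
apply/rowP => -[k k3]; rewrite mxE.
do 3?[case: k k3 => [|k] k3 /=]; last by [].
all: by congr (x _ _); apply/val_inj; rewrite /= inordK.
Qed.

Lemma row6P (x : 'rV[A]_6) : exists a b c d e f, x = row6 a b c d e f.
Proof.
exists (x ord0 (inord 0)), (x ord0 (inord 1)), (x ord0 (inord 2)).
exists (x ord0 (inord 3)), (x ord0 (inord 4)), (x ord0 (inord 5)).
apply/rowP => -[k k6]; rewrite mxE.
do 6?[case: k k6 => [|k] k6 /=]; last by [].
all: by congr (x _ _); apply/val_inj; rewrite /= inordK.
Qed.

Lemma row3D a b c a' b' c' :
  row3 a b c + row3 a' b' c' = row3 (a + a') (b + b') (c + c').
Proof. by apply/rowP => -[k k3]; rewrite !mxE; do 3?[case: k k3 => [|k] k3 //=]. Qed.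

Lemma row3Z t a b c : t *: row3 a b c = row3 (t * a) (t * b) (t * c).
Proof. by apply/rowP => -[k k3]; rewrite !mxE; do 3?[case: k k3 => [|k] k3 //=]. Qed.

Lemma row6D a b c d e f a' b' c' d' e' f' :
  row6 a b c d e f + row6 a' b' c' d' e' f'
    = row6 (a + a') (b + b') (c + c') (d + d') (e + e') (f + f').
Proof. by apply/rowP => -[k k6]; rewrite !mxE; do 6?[case: k k6 => [|k] k6 //=]. Qed.

Lemma row6Z t a b c d e f :
  t *: row6 a b c d e f = row6 (t * a) (t * b) (t * c) (t * d) (t * e) (t * f).
Proof. by apply/rowP => -[k k6]; rewrite !mxE; do 6?[case: k k6 => [|k] k6 //=]. Qed.

Lemma row3_inj a b c a' b' c' : row3 a b c = row3 a' b' c' ->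
  [/\ a = a', b = b' & c = c'].
Proof.
move=> e; split.
- by have := congr1 (fun x : 'rV[A]_3 => x ord0 (inord 0)) e; rewrite !mxE !inordK.
- by have := congr1 (fun x : 'rV[A]_3 => x ord0 (inord 1)) e; rewrite !mxE !inordK.
- by have := congr1 (fun x : 'rV[A]_3 => x ord0 (inord 2)) e; rewrite !mxE !inordK.
Qed.

Lemma row6_inj a b c d e f a' b' c' d' e' f' :
  row6 a b c d e f = row6 a' b' c' d' e' f' ->
  [/\ a = a', b = b' & c = c'] /\ [/\ d = d', e = e' & f = f'].
Proof.
move=> h; split; split.
- by have := congr1 (fun x : 'rV[A]_6 => x ord0 (inord 0)) h; rewrite !mxE !inordK.
- by have := congr1 (fun x : 'rV[A]_6 => x ord0 (inord 1)) h; rewrite !mxE !inordK.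
- by have := congr1 (fun x : 'rV[A]_6 => x ord0 (inord 2)) h; rewrite !mxE !inordK.
- by have := congr1 (fun x : 'rV[A]_6 => x ord0 (inord 3)) h; rewrite !mxE !inordK.
- by have := congr1 (fun x : 'rV[A]_6 => x ord0 (inord 4)) h; rewrite !mxE !inordK.
- by have := congr1 (fun x : 'rV[A]_6 => x ord0 (inord 5)) h; rewrite !mxE !inordK.
Qed.

Lemma row3_0 : row3 0 0 0 = 0.
Proof. by apply/rowP => -[k k3]; rewrite !mxE; do 3?[case: k k3 => [|k] k3 //=]. Qed.

Lemma row6_0 : row6 0 0 0 0 0 0 = 0.
Proof. by apply/rowP => -[k k6]; rewrite !mxE; do 6?[case: k k6 => [|k] k6 //=]. Qed.

Lemma row6M a b c d e f a' b' c' d' e' f' :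
  (row6 a b c d e f *m col6 a' b' c' d' e' f') ord0 ord0
    = a * a' + b * b' + c * c' + d * d' + e * e' + f * f'.
Proof. by rewrite mxE !big_ord_recr big_ord0 /= !mxE /= add0r. Qed.

Lemma row3M a b c (w : 'cV[A]_3) : (row3 a b c *m w) ord0 ord0
  = a * w ord0 ord0 + b * w (inord 1) ord0 + c * w (inord 2) ord0.
Proof.
rewrite mxE !big_ord_recr big_ord0 /= !mxE /= add0r.
by congr (_ * w _ _ + _ * w _ _ + _ * w _ _); apply/val_inj; rewrite /= ?inordK.
Qed.

Lemma mul_rows3 (u0 u1 u2 : A) (r0 r1 r2 : 'rV[A]_6) :
  row3 u0 u1 u2 *m (\matrix_(j < 3) [:: r0; r1; r2]`_j)
    = u0 *: r0 + u1 *: r1 + u2 *: r2.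
Proof.
rewrite mulmx_sum_row !big_ord_recr big_ord0 /= add0r !rowK !mxE /=.
by [].
Qed.

End Coordinates.

Section PluckerReal.
Variable R : realType.
Local Notation C := R[i].

(** Plucker vector of the line through p in direction v; it is (v, p x v). *)
Definition plk (p v : 'rV[R]_3) : 'rV[C]_6 :=
  plucker (homog_coord p) (homog_coord (p + v)).

Lemma plkE p0 p1 p2 v0 v1 v2 : plk (row3 p0 p1 p2) (row3 v0 v1 v2) =
  row6 v0%:C v1%:C v2%:C (p1%:C * v2%:C - p2%:C * v1%:C)
    (p2%:C * v0%:C - p0%:C * v2%:C) (p0%:C * v1%:C - p1%:C * v0%:C).
Proof.
rewrite /plk row3D; apply/rowP => -[k k6]; rewrite !mxE /=.
do 6?[case: k k6 => [|k] k6 /=]; last by [].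
all: rewrite !inordK //= ?(rmorphD, rmorphN, rmorphM) /=; ring.
Qed.

Definition line (p v : 'rV[R]_3) : set 'rV[R]_3 := [set p + t *: v | t in [set: R]].

Definition cross (u v : 'rV[R]_3) : 'rV[R]_3 :=
  let c (x : 'rV[R]_3) (k : nat) := x ord0 (inord k) in
  row3 (c u 1%N * c v 2%N - c u 2%N * c v 1%N)
       (c u 2%N * c v 0%N - c u 0%N * c v 2%N)
       (c u 0%N * c v 1%N - c u 1%N * c v 0%N).

Lemma crossE a b c a' b' c' : cross (row3 a b c) (row3 a' b' c')
  = row3 (b * c' - c * b') (c * a' - a * c') (a * b' - b * a').
Proof. by rewrite /cross !mxE !inordK. Qed.

Lemma cross0_scale (v v' : 'rV[R]_3) : v' != 0 -> cross v v' = 0 -> exists s, v = s *: v'.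
Proof.
have [a [b [c ->]]] := row3P v; have [a' [b' [c' ->]]] := row3P v'.
rewrite crossE -row3_0 => v'0 /row3_inj[/subr0_eq h1 /subr0_eq h2 /subr0_eq h3].
have [a0|a0] := eqVneq a' 0; last first.
  exists (a / a'); rewrite row3Z; congr (row3 _ _ _).
  - by rewrite divfK.
  - by apply: (mulIf a0); rewrite mulrAC divfK // -h3.
  - by apply: (mulIf a0); rewrite mulrAC divfK // h2.
have [b0|b0] := eqVneq b' 0; last first.
  exists (b / b'); rewrite row3Z; congr (row3 _ _ _).
  - by apply: (mulIf b0); rewrite mulrAC divfK // h3.
  - by rewrite divfK.
  - by apply: (mulIf b0); rewrite mulrAC divfK // -h1.
have [c0|c0] := eqVneq c' 0; first by rewrite a0 b0 c0 eqxx in v'0.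
exists (c / c'); rewrite row3Z; congr (row3 _ _ _).
- by apply: (mulIf c0); rewrite mulrAC divfK // -h2.
- by apply: (mulIf c0); rewrite mulrAC divfK // h1.
- by rewrite divfK.
Qed.

Lemma line_parallel p v v' : v != 0 -> v' != 0 -> cross v v' = 0 -> line p v = line p v'.
Proof.
move=> v0 v'0 /(cross0_scale v'0)[s es].
have s0 : s != 0 by apply: contraNneq v0 => s0; rewrite es s0 scale0r.
apply/seteqP; split => _ [t _ <-].
  by exists (t * s) => //; rewrite es scalerA.
by exists (t / s) => //; rewrite es scalerA divfK.
Qed.

Lemma line_through l p : is_line l -> l p -> exists2 v, v != 0 & l = line p v.
Proof.
move=> [a [v [v0 ->]]] [s _ <-]; exists v => //.
apply/seteqP; split => _ [t _ <-].
  exists (t - s) => //; rewrite -addrA -scalerDl; congr (a + _ *: v); ring.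
by exists (s + t) => //; rewrite scalerDl addrA.
Qed.

Lemma cone_plk (T : set {vspace 'rV[C]_6}) p v : v != 0 ->
  plucker_image (line p v) `<=` T -> cone T (plk p v).
Proof.
move=> v0 lT; split; first exact: plucker_homog_coord_neq0.
apply: lT; exists p, (p + v); split => //.
- by exists 0 => //; rewrite scale0r addr0.
- by exists 1 => //; rewrite scale1r.
- move=> /eqP; rewrite -subr_eq0 opprD addNKr oppr_eq0; exact/negP.
Qed.

Lemma realC_eq0 (x : R) : (x%:C == 0 :> C) = (x == 0).
Proof. exact: (fmorph_eq0 (real_complex R)). Qed.

(** The first three Plucker coordinates of a line give its direction. *)
Lemma plk_span p v v' : <[plk p v]>%VS = <[plk p v']>%VS -> cross v v' = 0.
Proof.
move=> e; have : plk p v \in <[plk p v']>%VS by rewrite -e memv_line.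
move=> /vlineP[t]; have [x [y [z ->]]] := row3P p.
have [a [b [c ->]]] := row3P v; have [a' [b' [c' ->]]] := row3P v'.
rewrite !plkE row6Z => /row6_inj[[ha hb hc] _]; rewrite crossE -row3_0.
congr row3; apply/eqP; rewrite -realC_eq0 rmorphB !rmorphM /=; apply/eqP;
  rewrite ?ha ?hb ?hc; ring.
Qed.

(** The polar form of the Klein quadric: lines x and y meet when [y *m polar x] is 0. *)
Definition polar (x : 'rV[C]_6) : 'cV[C]_6 :=
  let c (k : nat) := x ord0 (inord k) in
  col6 (c 3%N) (c 4%N) (c 5%N) (c 0%N) (c 1%N) (c 2%N).

Lemma polarE a b c d e f : polar (row6 a b c d e f) = col6 d e f a b c.
Proof. by rewrite /polar !mxE !inordK. Qed.

(** On a Plucker vector (v, w) this is q . (w - p x v), which vanishes on the lines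
    through p for every q. *)
Definition point_form (p q : 'rV[R]_3) : 'cV[C]_6 :=
  let c (x : 'rV[R]_3) (k : nat) := (x ord0 (inord k))%:C in
  col6 (c q 2%N * c p 1%N - c q 1%N * c p 2%N)
       (c q 0%N * c p 2%N - c q 2%N * c p 0%N)
       (c q 1%N * c p 0%N - c q 0%N * c p 1%N)
       (c q 0%N) (c q 1%N) (c q 2%N).

Lemma point_formE p0 p1 p2 a b c : point_form (row3 p0 p1 p2) (row3 a b c) =
  col6 (c%:C * p1%:C - b%:C * p2%:C) (a%:C * p2%:C - c%:C * p0%:C)
       (b%:C * p0%:C - a%:C * p1%:C) a%:C b%:C c%:C.
Proof. by rewrite /point_form !mxE !inordK. Qed.

Lemma mx11_eq0 (M : 'M[C]_1) : M ord0 ord0 = 0 -> M = 0.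
Proof. by move=> h; rewrite [M]mx11_scalar h raddf0. Qed.

(** The data of [many_curves_contradiction] for k points p + tau i u on a line that is
    not special: the polar of the line is lam, and mu i is the form vanishing on the
    lines through the i-th point, with a multiplier q orthogonal to none of the
    normals u x v i j. *)
Lemma rich_points_on_line_contradiction (T : set {vspace 'rV[C]_6}) (Y : seq 'rV[C]_6) k p u
    (tau : 'I_k -> R) (v : 'I_k -> 'I_k -> 'rV[R]_3) :
  irreducible_variety T -> (size Y < k ^ 3)%N ->
  (forall s : {mpoly C[6]}, s \is (3 * k.-1).-homog ->
    (forall z, z \in Y -> s.@[z ord0] = 0) -> vanishes T s) ->
  ~ vanishes T (lform (polar (plk p u))) -> injective tau ->
  (forall i j, cone T (plk (p + tau i *: u) (v i j))) ->
  (forall i j, cross u (v i j) != 0) ->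
  (forall i j j', j != j' -> cross (v i j) (v i j') != 0) -> False.
Proof.
move=> irrT sY hY nsp tinj vT uv vv.
have [w hw] : exists w : 'cV[R]_3, forall x,
    x \in [seq cross u (v ij.1 ij.2) | ij : 'I_k * 'I_k] -> (x *m w) ord0 ord0 != 0.
  by apply: avoid_vectors; apply/allP => _ /mapP[[i j] _ ->]; apply: uv.
have {}hw i j : (cross u (v i j) *m w) ord0 ord0 != 0.
  by apply: hw; apply/mapP; exists (i, j); rewrite ?mem_enum.
pose q := row3 (w ord0 ord0) (w (inord 1) ord0) (w (inord 2) ord0).
have [p0 [p1 [p2 ep]]] := row3P p; have [u0 [u1 [u2 eu]]] := row3P u.
pose y i j := plk (p + tau i *: u) (v i j).
apply: (@many_curves_contradiction C 5 T irrT k (polar (plk p u))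
  (fun i => point_form (p + tau i *: u) q) y Y) => //.
- by move=> i j j' jj'; apply/negP => /eqP/plk_span e; case/eqP: (vv i j j' jj').
- move=> i j; apply: mx11_eq0; rewrite /y.
  have [a [b [c ->]]] := row3P (v i j).
  rewrite ep eu row3Z row3D !plkE polarE row6M !(rmorphD, rmorphM) /=; ring.
- move=> i j; apply: mx11_eq0; rewrite /y.
  have [a [b [c ->]]] := row3P (v i j).
  rewrite ep eu row3Z row3D !plkE point_formE row6M !(rmorphD, rmorphM) /=; ring.
- move=> i i' j i'i; have := hw i j; rewrite /y.
  have [a [b [c ->]]] := row3P (v i j).
  rewrite ep eu row3Z row3D row3Z row3D !plkE point_formE row6M crossE row3M.
  set D := (X in X != 0 -> _) => D0.
  have t0 : tau i - tau i' != 0 by rewrite subr_eq0 (inj_eq tinj) eq_sym.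
  rewrite [X in X != 0](_ : _ = ((tau i - tau i') * D)%:C); last first.
    rewrite /D !(rmorphD, rmorphN, rmorphM) /=; ring.
  by rewrite realC_eq0 mulf_neq0.
Qed.

End PluckerReal.

(** * Lines that meet every line of the congruence *)

Section PolarHyperplanes.
Variable R : realType.
Local Notation C := R[i].

Lemma complex_uncountable : ~ countable [set: C].
Proof.
move=> /countable_injP[f finj]; apply: (@realType_uncountable R).
apply/countable_injP; exists (fun x => f x%:C) => x y _ _ e.
by have := finj x%:C y%:C (in_setT _) (in_setT _) e => -[].
Qed.

Lemma submx_rows3 (r0 r1 r2 : 'rV[C]_6) a b c :
  ((a *: r0 + b *: r1 + c *: r2)%R <= \matrix_(j < 3) [:: r0; r1; r2]`_j)%MS.
Proof. by apply/submxP; exists (row3 a b c); rewrite mul_rows3. Qed.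

(** Let (v, w) be in T and W = w - p x v.  The two polar equations say that W is orthogonal
    to v1 and v2, hence proportional to their cross product n, and the quadric that W
    is orthogonal to v.  So (n . W) (n . v) vanishes on T, and one factor does.  If
    n . W = 0 then W = 0 and the lines of T pass through p; if n . v = 0 they lie in
    the plane through p with directions v1 and v2.  Both cases put T in a flat. *)
Lemma polar_hyperplanes_parallel (T : set {vspace 'rV[C]_6}) p v1 v2 :
  T `<=` @klein_quadric C -> irreducible_variety T -> has_chain T 2 ->
  (forall W : {vspace 'rV[C]_6}, \dim W = 3%N -> T <> flat W) ->
  vanishes T (lform (polar (plk p v1))) -> vanishes T (lform (polar (plk p v2))) ->
  cross v1 v2 = 0.
Proof.
move=> TQ irrT chT nonplanar Tv1 Tv2; apply/eqP/negPn/negP.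
have noflat (K : 'M[C]_(3, 6)) : row_free K -> (forall x, cone T x -> (x <= K)%MS) -> False.
  move=> fK TK.
  by have [W dW] := contained_in_flat complex_uncountable irrT chT fK TK; apply: nonplanar.
move: Tv1 Tv2; have [p0 [p1 [p2 ->]]] := row3P p.
have [a0 [a1 [a2 ->]]] := row3P v1; have [b0 [b1 [b2 ->]]] := row3P v2.
rewrite !plkE !polarE crossE => Tv1 Tv2.
set n0 := a1 * b2 - a2 * b1; set n1 := a2 * b0 - a0 * b2; set n2 := a0 * b1 - a1 * b0.
move=> nz.
have nn : n0 ^+ 2 + n1 ^+ 2 + n2 ^+ 2 != 0.
  apply: contraNneq nz => /eqP.
  rewrite paddr_eq0 ?addr_ge0 ?sqr_ge0 // paddr_eq0 ?sqr_ge0 // !sqrf_eq0.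
  by move=> /andP[/andP[/eqP -> /eqP ->] /eqP ->]; rewrite row3_0.
have {nz nn} : n0%:C ^+ 2 + n1%:C ^+ 2 + n2%:C ^+ 2 != 0 :> C.
  by rewrite -!rmorphXn -!rmorphD /= realC_eq0.
have -> : n0%:C = a1%:C * b2%:C - a2%:C * b1%:C :> C by rewrite rmorphB !rmorphM.
have -> : n1%:C = a2%:C * b0%:C - a0%:C * b2%:C :> C by rewrite rmorphB !rmorphM.
have -> : n2%:C = a0%:C * b1%:C - a1%:C * b0%:C :> C by rewrite rmorphB !rmorphM.
move: Tv1 Tv2; move: p0%:C p1%:C p2%:C a0%:C a1%:C a2%:C b0%:C b1%:C b2%:C.
move=> {}p0 {}p1 {}p2 {}a0 {}a1 {}a2 {}b0 {}b1 {}b2 {n0 n1 n2} Tv1 Tv2.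
set n0 := a1 * b2 - a2 * b1; set n1 := a2 * b0 - a0 * b2; set n2 := a0 * b1 - a1 * b0.
set nn := n0 ^+ 2 + n1 ^+ 2 + n2 ^+ 2 => nn0.
(* from here on the coordinates of p, v1, v2 stand for their images in C *)
have KT x : cone T x -> forall x0 x1 x2 x3 x4 x5, x = row6 x0 x1 x2 x3 x4 x5 ->
    let w0 := x3 - (p1 * x2 - p2 * x1) in
    let w1 := x4 - (p2 * x0 - p0 * x2) in
    let w2 := x5 - (p0 * x1 - p1 * x0) in
    [/\ a0 * w0 + a1 * w1 + a2 * w2 = 0, b0 * w0 + b1 * w1 + b2 * w2 = 0
      & x0 * w0 + x1 * w1 + x2 * w2 = 0].
  move=> Tx x0 x1 x2 x3 x4 x5 ex; split.
  - have := Tv1 x Tx; rewrite lformE ex row6M => <-; ring.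
  - have := Tv2 x Tx; rewrite lformE ex row6M => <-; ring.
  - have [_ /TQ[_ /(_ x (memv_line x))]] := Tx.
    rewrite ex !mxE !inordK //= => <-; ring.
pose f1 := lform (col6 (n2 * p1 - n1 * p2) (n0 * p2 - n2 * p0) (n1 * p0 - n0 * p1) n0 n1 n2).
pose f2 := lform (col6 n0 n1 n2 0 0 0).
have f1E x0 x1 x2 x3 x4 x5 : f1.@[row6 x0 x1 x2 x3 x4 x5 ord0]
   = n0 * (x3 - (p1 * x2 - p2 * x1)) + n1 * (x4 - (p2 * x0 - p0 * x2))
     + n2 * (x5 - (p0 * x1 - p1 * x0)).
  by rewrite lformE row6M; ring.
have f2E x0 x1 x2 x3 x4 x5 : f2.@[row6 x0 x1 x2 x3 x4 x5 ord0]
   = n0 * x0 + n1 * x1 + n2 * x2.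
  by rewrite lformE row6M; ring.
(* a vector orthogonal to both directions is proportional to n *)
have wn w0 w1 w2 : a0 * w0 + a1 * w1 + a2 * w2 = 0 -> b0 * w0 + b1 * w1 + b2 * w2 = 0 ->
    [/\ nn * w0 = n0 * (n0 * w0 + n1 * w1 + n2 * w2),
        nn * w1 = n1 * (n0 * w0 + n1 * w1 + n2 * w2) &
        nn * w2 = n2 * (n0 * w0 + n1 * w1 + n2 * w2)].
  move=> ha hb.
  have k0 : n1 * w2 - n2 * w1 = 0.
    transitivity (b0 * (a0 * w0 + a1 * w1 + a2 * w2) - a0 * (b0 * w0 + b1 * w1 + b2 * w2)); first by rewrite /n1 /n2; ring.
    by rewrite ha hb !mulr0 subrr.
  have k1 : n2 * w0 - n0 * w2 = 0.
    transitivity (b1 * (a0 * w0 + a1 * w1 + a2 * w2) - a1 * (b0 * w0 + b1 * w1 + b2 * w2)); first by rewrite /n0 /n2; ring.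
    by rewrite ha hb !mulr0 subrr.
  have k2 : n0 * w1 - n1 * w0 = 0.
    transitivity (b2 * (a0 * w0 + a1 * w1 + a2 * w2) - a2 * (b0 * w0 + b1 * w1 + b2 * w2)); first by rewrite /n0 /n1; ring.
    by rewrite ha hb !mulr0 subrr.
  split.
  - apply: subr0_eq; transitivity (n2 * (n2 * w0 - n0 * w2) - n1 * (n0 * w1 - n1 * w0)); first by rewrite /nn; ring.
    by rewrite k1 k2 !mulr0 subrr.
  - apply: subr0_eq; transitivity (n0 * (n0 * w1 - n1 * w0) - n2 * (n1 * w2 - n2 * w1)); first by rewrite /nn; ring.
    by rewrite k0 k2 !mulr0 subrr.
  - apply: subr0_eq; transitivity (n1 * (n1 * w2 - n2 * w1) - n0 * (n2 * w0 - n0 * w2)); first by rewrite /nn; ring.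
    by rewrite k0 k1 !mulr0 subrr.
have : vanishes T (f1 * f2).
  move=> x Tx; have [x0 [x1 [x2 [x3 [x4 [x5 ex]]]]]] := row6P x.
  have /= [ha hb hq] := KT x Tx _ _ _ _ _ _ ex.
  have [e0 e1 e2] := wn _ _ _ ha hb.
  rewrite mevalM ex f1E f2E.
  set w0 := x3 - _ in ha hb hq e0 e1 e2 *; set w1 := x4 - _ in ha hb hq e0 e1 e2 *.
  set w2 := x5 - _ in ha hb hq e0 e1 e2 *.
  transitivity (x0 * (nn * w0) + x1 * (nn * w1) + x2 * (nn * w2)).
    by rewrite e0 e1 e2; ring.
  transitivity (nn * (x0 * w0 + x1 * w1 + x2 * w2)); first by ring.
  by rewrite hq mulr0.
case/(vanishes_prime irrT) => Tf.
  apply: (noflat (\matrix_(j < 3) [:: row6 1 0 0 0 p2 (- p1); row6 0 1 0 (- p2) 0 p0;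
                                      row6 0 0 1 p1 (- p0) 0]`_j)).
    apply: inj_row_free => u; have [u0 [u1 [u2 ->]]] := row3P u.
    rewrite mul_rows3 !row6Z !row6D -row6_0 => /row6_inj[[h0 h1 h2] _].
    rewrite -row3_0; congr row3; [rewrite -h0 | rewrite -h1 | rewrite -h2]; ring.
  move=> x Tx; have [x0 [x1 [x2 [x3 [x4 [x5 ex]]]]]] := row6P x.
  have /= [ha hb hq] := KT x Tx _ _ _ _ _ _ ex.
  have [e0 e1 e2] := wn _ _ _ ha hb.
  have := Tf x Tx; rewrite ex f1E => f0; rewrite f0 !mulr0 in e0 e1 e2.
  move/eqP: e0; rewrite mulf_eq0 (negPf nn0) => /eqP/subr0_eq ->.
  move/eqP: e1; rewrite mulf_eq0 (negPf nn0) => /eqP/subr0_eq ->.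
  move/eqP: e2; rewrite mulf_eq0 (negPf nn0) => /eqP/subr0_eq ->.
  rewrite [X in (X <= _)%MS](_ : _ = x0 *: row6 1 0 0 0 p2 (- p1)
    + x1 *: row6 0 1 0 (- p2) 0 p0 + x2 *: row6 0 0 1 p1 (- p0) 0).
    exact: submx_rows3.
  by rewrite !row6Z !row6D; congr row6; ring.
pose r1 := row6 a0 a1 a2 (p1 * a2 - p2 * a1) (p2 * a0 - p0 * a2) (p0 * a1 - p1 * a0).
pose r2 := row6 b0 b1 b2 (p1 * b2 - p2 * b1) (p2 * b0 - p0 * b2) (p0 * b1 - p1 * b0).
apply: (noflat (\matrix_(j < 3) [:: r1; r2; row6 0 0 0 n0 n1 n2]`_j)).
  apply: inj_row_free => u; have [u0 [u1 [u2 ->]]] := row3P u.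
  rewrite mul_rows3 !row6Z !row6D -row6_0 => /row6_inj[[h0 h1 h2] [h3 h4 h5]].
  rewrite !mulr0 !addr0 in h0 h1 h2.
  have u00 : u0 = 0.
    apply: (mulfI nn0); rewrite mulr0 (_ : _ * _ =
      n0 * ((u0 * a1 + u1 * b1) * b2 - (u0 * a2 + u1 * b2) * b1)
    + n1 * ((u0 * a2 + u1 * b2) * b0 - (u0 * a0 + u1 * b0) * b2)
    + n2 * ((u0 * a0 + u1 * b0) * b1 - (u0 * a1 + u1 * b1) * b0)); last by rewrite /nn /n0 /n1 /n2; ring.
    by rewrite h0 h1 h2 !mul0r !subrr !mulr0 !addr0.
  have u10 : u1 = 0.
    apply: (mulfI nn0); rewrite mulr0 (_ : _ * _ =
      n0 * ((u0 * a2 + u1 * b2) * a1 - (u0 * a1 + u1 * b1) * a2)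
    + n1 * ((u0 * a0 + u1 * b0) * a2 - (u0 * a2 + u1 * b2) * a0)
    + n2 * ((u0 * a1 + u1 * b1) * a0 - (u0 * a0 + u1 * b0) * a1)); last by rewrite /nn /n0 /n1 /n2; ring.
    by rewrite h0 h1 h2 !mul0r !subrr !mulr0 !addr0.
  rewrite u00 u10 !mul0r !add0r in h3 h4 h5 *.
  have -> : u2 = 0.
    apply: (mulfI nn0); rewrite mulr0.
    transitivity (n0 * (u2 * n0) + n1 * (u2 * n1) + n2 * (u2 * n2)); first by rewrite /nn; ring.
    by rewrite h3 h4 h5 !mulr0 !addr0.
  exact: row3_0.
move=> x Tx; have [x0 [x1 [x2 [x3 [x4 [x5 ex]]]]]] := row6P x.
have /= [ha hb hq] := KT x Tx _ _ _ _ _ _ ex.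
have [e0 e1 e2] := wn _ _ _ ha hb.
have := Tf x Tx; rewrite ex f2E => g0.
set w0 := x3 - _ in ha hb hq e0 e1 e2; set w1 := x4 - _ in ha hb hq e0 e1 e2.
set w2 := x5 - _ in ha hb hq e0 e1 e2.
(* the coordinates of the direction (x0, x1, x2) on v1 and v2, scaled by nn *)
pose al := n0 * (x1 * b2 - x2 * b1) + n1 * (x2 * b0 - x0 * b2) + n2 * (x0 * b1 - x1 * b0).
pose be := n0 * (a1 * x2 - a2 * x1) + n1 * (a2 * x0 - a0 * x2) + n2 * (a0 * x1 - a1 * x0).
pose ga := n0 * w0 + n1 * w1 + n2 * w2.
have dv0 : nn * x0 = al * a0 + be * b0.
  rewrite (_ : nn * x0 = al * a0 + be * b0 + n0 * (n0 * x0 + n1 * x1 + n2 * x2)).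
    by rewrite g0 mulr0 addr0.
  by rewrite /al /be /nn /n0 /n1 /n2; ring.
have dv1 : nn * x1 = al * a1 + be * b1.
  rewrite (_ : nn * x1 = al * a1 + be * b1 + n1 * (n0 * x0 + n1 * x1 + n2 * x2)).
    by rewrite g0 mulr0 addr0.
  by rewrite /al /be /nn /n0 /n1 /n2; ring.
have dv2 : nn * x2 = al * a2 + be * b2.
  rewrite (_ : nn * x2 = al * a2 + be * b2 + n2 * (n0 * x0 + n1 * x1 + n2 * x2)).
    by rewrite g0 mulr0 addr0.
  by rewrite /al /be /nn /n0 /n1 /n2; ring.
suff : (nn *: row6 x0 x1 x2 x3 x4 x5 <= \matrix_(j < 3) [:: r1; r2; row6 0 0 0 n0 n1 n2]`_j)%MS.
  by move=> /(scalemx_sub nn^-1); rewrite scalerA mulVf // scale1r.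
rewrite [X in (X <= _)%MS](_ : _ = al *: r1 + be *: r2 + ga *: row6 0 0 0 n0 n1 n2).
  exact: submx_rows3.
rewrite /r1 /r2 !row6Z !row6D dv0 dv1 dv2.
congr row6; try ring.
- rewrite (_ : nn * x3 = nn * w0 + (p1 * (nn * x2) - p2 * (nn * x1))); last by rewrite /w0; ring.
  rewrite dv1 dv2 e0 -/ga; ring.
- rewrite (_ : nn * x4 = nn * w1 + (p2 * (nn * x0) - p0 * (nn * x2))); last by rewrite /w1; ring.
  rewrite dv0 dv2 e1 -/ga; ring.
- rewrite (_ : nn * x5 = nn * w2 + (p0 * (nn * x1) - p1 * (nn * x0))); last by rewrite /w2; ring.
  rewrite dv0 dv1 e2 -/ga; ring.
Qed.

End PolarHyperplanes.

(** * Counting incidences *)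

Section Incidences.
Variables (R : realType) (d : nat).
Local Notation C := R[i].
Let k := (9 * d ^ 3).+1.
Variable T : set {vspace 'rV[C]_6}.
Hypothesis TQ : T `<=` @klein_quadric C.
Hypothesis irrT : irreducible_variety T.
Hypothesis dimT : has_dimension T 2.
Hypothesis degT : has_degree T d.
Hypothesis nonplanar : forall W : {vspace 'rV[C]_6}, \dim W = 3%N -> T <> flat W.
Variables (n : nat) (L : set (set 'rV[R]_3)) (Ls : seq (set 'rV[R]_3)).
Hypothesis uLs : uniq Ls.
Hypothesis LsP : forall l, L l <-> l \in Ls.
Hypothesis lineL : forall l, L l -> is_line l.
Hypothesis LT : forall l, L l -> plucker_image l `<=` T.
Variable r : nat.
Hypothesis rk : (k < r)%N.

(** Every representation of l as a line is allowed, since its Plucker vector is defined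
    up to a scalar only. *)
Definition special (l : set 'rV[R]_3) := forall p v, v != 0 -> l = line p v ->
  vanishes T (lform (polar (plk p v))).

Lemma rich_lines p : rich_points L r p ->
  (r <= size [seq l <- Ls | `[< l p >]])%N.
Proof.
rewrite /rich_points /= => hr.
have fA : finite_set [set l | L l /\ l p].
  apply: (@sub_finite_set _ _ [set` Ls]); last exact: finite_seq.
  by move=> l [/LsP].
apply: leq_trans (leq_card_fset_set fA hr) _.
apply: uniq_leq_size; first exact: finmap.fset_uniq.
move=> l; rewrite in_fset_set // inE => -[/LsP lL lp].
by rewrite mem_filter lL andbT; apply/asboolP.
Qed.

(** The choice of k: with e = d^3 both sides start with 729 e^3, and the remaining terms
    on the left are at most 54 e^2 + e. *)
Lemma grid_size_lt Y : (Y <= d * (d * (3 * k.-1)).+1 ^ 2)%N -> (Y < k ^ 3)%N.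
Proof.
move=> h; apply: leq_ltn_trans h _; rewrite /k /=.
set e := (d ^ 3)%N; have ee : e = (d * d * d)%N by rewrite /e !expnS expn0 muln1 mulnA.
have d1 : (d * d <= e)%N by rewrite ee; case: (d) => // d'; rewrite leq_pmulr.
have d2 : (d <= e)%N by rewrite ee; case: (d) => // d'; rewrite leq_pmull.
rewrite !expnS !expn0 !muln1.
have -> : (d * ((d * (3 * (9 * e))).+1 * (d * (3 * (9 * e))).+1)
  = 729 * e * e * (d * d * d) + 54 * e * (d * d) + d)%N.
  nia.
rewrite -ee; nia.
Qed.

(** Each of k rich points on l has k lines of L other than l through it. *)
Lemma nonspecial_rich_points l (s : seq 'rV[R]_3) : L l -> ~ special l -> uniq s ->
  (forall p, p \in s -> rich_points L r p /\ l p) -> (size s < k)%N.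
Proof.
move=> Ll nsp us hs; rewrite ltnNge; apply/negP => ks.
have [p [u [u0 el nv]]] : exists p u, [/\ u != 0, l = line p u &
    ~ vanishes T (lform (polar (plk p u)))].
  apply: contrapT => h; apply: nsp => p v v0 el; apply: contrapT => nv.
  by apply: h; exists p, v.
have [Y [sY hY]] := interpolation_set (3 * k.-1) (@complex_uncountable R) irrT dimT degT.
pose pt (i : 'I_k) := s`_i.
have pts i : pt i \in s by rewrite mem_nth // (leq_trans (ltn_ord i)).
have /choice[tau htau] i : exists t, pt i = p + t *: u.
  by have [_] := hs _ (pts i); rewrite el => -[t _ <-]; exists t.
have ltau i : l = line (p + tau i *: u) u.
  have [_ lp] := hs _ (pts i); rewrite htau in lp.
  have [v v0 ev] := line_through (lineL Ll) lp.
  rewrite el; apply/seteqP; split => _ [t _ <-].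
    by exists (t - tau i) => //; rewrite -addrA -scalerDl; congr (p + _ *: u); ring.
  by exists (tau i + t) => //; rewrite scalerDl addrA.
have tau_inj : injective tau.
  move=> i j e; have : pt i = pt j by rewrite !htau e.
  by move/eqP; rewrite nth_uniq ?(leq_trans (ltn_ord _)) // => /eqP/val_inj.
pose ms i := rem l [seq m <- Ls | `[< m (pt i) >]].
have ums i : uniq (ms i) by rewrite rem_uniq // filter_uniq.
have sms i : (k <= size (ms i))%N.
  have := rich_lines (hs _ (pts i)).1; rewrite size_rem; last first.
    rewrite mem_filter; apply/andP; split; last exact/LsP.
    by apply/asboolP; case: (hs _ (pts i)).
  by move=> h; rewrite -ltnS prednK ?(leq_trans rk h) // (leq_ltn_trans _ (leq_trans rk h)).
pose m i (j : 'I_k) := nth set0 (ms i) j.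
have mms i j : m i j \in ms i by rewrite mem_nth // (leq_trans (ltn_ord j)).
have mP i j : [/\ m i j != l, L (m i j) & m i j (pt i)].
  have := mms i j; rewrite mem_rem_uniq ?filter_uniq // inE mem_filter => /and3P[ml /asboolP mp mL].
  by split => //; apply/LsP.
have /choice[v hv] : forall ij : 'I_k * 'I_k, exists v : 'rV[R]_3,
    v != 0 /\ m ij.1 ij.2 = line (pt ij.1) v.
  move=> [i j] /=; have [_ mL mp] := mP i j.
  by have [v v0 ->] := line_through (lineL mL) mp; exists v.
have {}hv i j : v (i, j) != 0 /\ m i j = line (p + tau i *: u) (v (i, j)).
  by have := hv (i, j); rewrite /= htau.
apply: (@rich_points_on_line_contradiction R T Y k p u tau (fun i j => v (i, j))) => //.
- exact: grid_size_lt.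
- move=> i j; have [v0 em] := hv i j; have [_ mL _] := mP i j.
  by apply: cone_plk => //; rewrite -em; apply: LT.
- move=> i j; have [v0 em] := hv i j; have [ml _ _] := mP i j.
  apply/negP => /eqP uv; case/eqP: ml.
  by rewrite em (ltau i); apply/esym/line_parallel.
- move=> i j j' jj'; have [v0 em] := hv i j; have [v0' em'] := hv i j'.
  apply/negP => /eqP vv; case/eqP: jj'; apply/val_inj/eqP.
  rewrite -(nth_uniq set0 _ _ (ums i)) ?(leq_trans (ltn_ord _)) //.
  by apply/eqP; rewrite -/(m i j) -/(m i j') em em'; apply: line_parallel.
Qed.

Lemma special_unique p l l' : L l -> L l' -> special l -> special l' ->
  l p -> l' p -> l = l'.
Proof.
move=> Ll Ll' sl sl' lp lp'.
have [v v0 el] := line_through (lineL Ll) lp.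
have [v' v0' el'] := line_through (lineL Ll') lp'.
rewrite el el'; apply: line_parallel => //.
have [chT _] := dimT.
exact: (polar_hyperplanes_parallel TQ irrT chT nonplanar (sl p v v0 el) (sl' p v' v0' el')).
Qed.

(** Double counting of the incidences with the lines that are not special: at least
    r - 1 at each point, at most k - 1 on each line. *)
Lemma rich_points_count (s : seq 'rV[R]_3) : uniq s ->
  (forall p, p \in s -> rich_points L r p) ->
  (size s * r.-1 <= k.-1 * size Ls)%N.
Proof.
move=> us hs.
have sumc (S : eqType) (t : seq S) c : (\sum_(i <- t) c = c * size t)%N.
  by rewrite big_const_seq count_predT iter_addn_0.
pose P (p : 'rV[R]_3) (l : set 'rV[R]_3) := `[< l p >] && ~~ `[< special l >].
apply: (@leq_trans (\sum_(p <- s) count (P p) Ls)).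
  rewrite mulnC -sumc big_seq [X in (_ <= X)%N]big_seq.
  apply: leq_sum => p ps; set A := [seq l <- Ls | `[< l p >]].
  have -> : count (P p) Ls = count (predC (fun l => `[< special l >])) A.
    by rewrite count_filter; apply: eq_count => l; rewrite /P /= andbC.
  have := rich_lines (hs p ps); rewrite -/A -(count_predC (fun l => `[< special l >]) A).
  have : (count (fun l => `[< special l >]) A <= 1)%N.
    rewrite -size_filter; set B := filter _ A.
    have uB : uniq B by rewrite !filter_uniq.
    have hB x : x \in B -> [/\ special x, L x & x p].
      by rewrite !mem_filter => /and3P[/asboolP ? /asboolP ? /LsP].
    case: B uB hB => [|x [|y B]] //= /andP[]; rewrite inE negb_or => /andP[xy _] _ hB.
    have [sx Lx xp] := hB x (mem_head _ _).
    have [|sy Ly yp] := hB y; first by rewrite !inE eqxx orbT.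
    by rewrite (special_unique Lx Ly sx sy xp yp) eqxx in xy.
  by move: rk; lia.
under eq_bigr do rewrite -sum1_count big_mkcond.
rewrite exchange_big /= -sumc [leqLHS]big_seq [leqRHS]big_seq.
apply: leq_sum => l /LsP Ll; rewrite -big_mkcond sum1_count /P.
have [sl|nsl] := pselect (special l).
  rewrite (@eq_count _ _ pred0) ?count_pred0 // => p.
  by rewrite (asboolT sl) andbF.
rewrite -ltnS -size_filter; apply: (nonspecial_rich_points Ll nsl).
  by rewrite filter_uniq.
move=> p; rewrite mem_filter => /andP[/andP[/asboolP lp _] /hs].
by split.
Qed.

End Incidences.

Theorem corollary4p3 (R : realType) (d : nat) :
  exists (r0 : nat) (C : R), (0 < r0)%N /\
    forall T : set {vspace 'rV[R[i]]_6},
      T `<=` @klein_quadric R[i] ->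
      irreducible_variety T ->
      has_dimension T 2 ->
      has_degree T d ->
      (forall W : {vspace 'rV[R[i]]_6}, \dim W = 3%N -> T <> flat W) ->
      forall (n : nat) (L : set (set 'rV[R]_3)),
        L #= `I_n ->
        (forall l, L l -> is_line l) ->
        (forall l, L l -> plucker_image l `<=` T) ->
        forall r : nat, (r0 <= r)%N ->
          exists m : nat, rich_points L r #= `I_m /\
            m%:R <= C * (n%:R / r%:R).
Proof.
pose k := (9 * d ^ 3)%N.
exists k.+2, (2 * k)%:R; split => // T TQ irrT dimT degT nonplanar n L Ln lineL LT r rk.
have [Ls [uLs sLs LsP]] := card_II_seq Ln.
have count s := @rich_points_count R d T TQ irrT dimT degT nonplanar L Ls uLs LsP lineL LT r rk s.
have finA : finite_set (rich_points L r).
  apply: contrapT => inf; have [B BA sB] := infinite_set_fset (k * n).+1 inf.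
  have := count (finmap.enum_fset B) (finmap.fset_uniq B) (fun p pB => BA p pB).
  rewrite sLs -/k leqNgt => /negP; apply; apply: leq_trans sB _.
  by rewrite leq_pmulr //; move: rk; lia.
have /finite_setP[m Am] := finA; exists m; split => //.
have [s [us ss hs]] := card_II_seq Am.
have := count s us (fun p ps => (hs p).2 ps); rewrite ss sLs -/k => h.
have r0 : (0 < r)%N by move: rk; lia.
rewrite mulrA ler_pdivlMr ?ltr0n // -!natrM ler_nat.
by move: rk h; case: r r0 {count finA Am hs} => //= r _; nia.
Qed.
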